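(* Let $(q_j)_{j\in\mathbb{N}}$ be a sequence of positive real numbers and, for each $n\in\mathbb{N}$, let $g_n(x)=(2\pi\hbar)^{-n/2}e^{-\frac1{2\hbar}\sum_{j=1}^nq_jx_j^2}$, $x\in\mathbb{R}^n$. Consider the functionals $L_n:M^{\infty,1}(\mathbb{R}^n)\to\mathbb{C}$, $L_n(f)=\widetilde{\int_{\mathbb{R}^n}}e^{\frac i{2\hbar}|x|^2}f(x)\,dx$, with operator norms $$\|L_n\|=\sup_{f\in M^{\infty,1}(\mathbb{R}^n)\setminus\{0\}}\frac{|L_n(f)|}{\|f\|_{M^{\infty,1}_{(g_n)}(\mathbb{R}^n)}}.$$ If $\sum_{n\in\mathbb{N}}q_n^2<\infty$, then $\sup_{n\in\mathbb{N}}\|L_n\|<\infty$.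
   Context: Fix $\hbar\in(0,1]$; $i^{s}=e^{i\pi s/2}$, so $(2\pi i\hbar)^{-n/2}=(2\pi\hbar)^{-n/2}e^{-i\pi n/4}$. For $g\in\mathcal{S}(\mathbb{R}^n)$ and $f\in\mathcal{S}'(\mathbb{R}^n)$, $V_gf(x,\xi)$ is the Fourier transform of $f\,\overline{g(\cdot-x)}$ at $\xi$, normalized as $V_gf(x,\xi)=(2\pi\hbar)^{-n/2}\int e^{-\frac i\hbar\xi\cdot y}f(y)\overline{g(y-x)}\,dy$. $\|f\|_{M^{\infty,1}_{(g)}(\mathbb{R}^n)}=\int_{\mathbb{R}^n}\sup_x|V_gf(x,\xi)|\,d\xi$, and $M^{\infty,1}(\mathbb{R}^n)$ is the space of $f\in\mathcal{S}'(\mathbb{R}^n)$ for which this is finite for some (equivalently every) $g\in\mathcal{S}(\mathbb{R}^n)\setminus\{0\}$; its elements are bounded continuous functions. $\widetilde{\int_{\mathbb{R}^n}}e^{\frac i{2\hbar}|x|^2}f(x)\,dx:=\lim_{\varepsilon\downarrow0}(2\pi i\hbar)^{-n/2}\int_{\mathbb{R}^n}e^{\frac i{2\hbar}|x|^2}f(x)\varphi(\varepsilon x)\,dx$ for any $\varphi\in\mathcal{S}(\mathbb{R}^n)$ with $\varphi(0)=1$ (for $f\in M^{\infty,1}(\mathbb{R}^n)$ the limit exists and is independent of $\varphi$). *)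

(* Defs.v *)
From HB Require Import structures.
From mathcomp Require Import all_boot all_order all_algebra.
From mathcomp Require Import complex.
From mathcomp Require Import all_classical all_reals all_analysis.

Set Implicit Arguments.
Unset Strict Implicit.
Unset Printing Implicit Defensive.
Import Order.TTheory GRing.Theory Num.Theory.
Import numFieldNormedType.Exports.

Local Open Scope classical_set_scope.
Local Open Scope ring_scope.
Local Open Scope complex_scope.

(* R^n is 'rV[R]_n; its norm `|x| is the sup norm of mathcomp-analysis, while
   the |x|^2 of the oscillatory factor is the Euclidean dotv x x. *)
Definition dotv (R : realType) (n : nat) (x y : 'rV[R]_n) : R :=
  \sum_(j < n) x 0 j * y 0 j.

(* e^{it} *)
Definition expi (R : realType) (t : R) : R[i] := cos t +i* sin t.

(* n-dimensional Lebesgue measure.  mathcomp-analysis has a sigma-algebra on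
   n.-tuple T but none on 'rV[R]_n, so the measure lives on tuples: it is the
   n-fold product of the one-dimensional Lebesgue measure, transported along
   R^n x R ~ R^{n+1}. *)
Section lebesgue_n.
Variable R : realType.

Definition tcons (n : nat)
    (p : n.-tuple (measurableTypeR R) * measurableTypeR R) :
    n.+1.-tuple (measurableTypeR R) :=
  [the n.+1.-tuple _ of p.2 :: p.1].

Lemma measurable_tcons (n : nat) : measurable_fun setT (@tcons n).
Proof. exact: measurable_cons. Qed.

Definition lebn_step (n : nat)
    (mu : {measure set (n.-tuple (measurableTypeR R)) -> \bar R}) :
  {measure set (n.+1.-tuple (measurableTypeR R)) -> \bar R}.
Proof.
refine (pushforward (mu \x (@lebesgue_measure R))%E (@tcons n)).
exact: measurable_tcons.
Defined.

Fixpoint lebn (n : nat) :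
    {measure set (n.-tuple (measurableTypeR R)) -> \bar R} :=
  match n with
  | 0 => dirac ([tuple] : 0.-tuple (measurableTypeR R))
  | m.+1 => lebn_step (lebn m)
  end.

Definition rV_of_tuple (n : nat) (t : n.-tuple (measurableTypeR R)) :
    'rV[R]_n := \row_j tnth t j.

(* \int_{R^n} F(x) dx for F >= 0 *)
Definition integral_rV (n : nat) (F : 'rV[R]_n -> \bar R) : \bar R :=
  (\int[lebn n]_t F (rV_of_tuple t))%E.

End lebesgue_n.

Section schwartz.
Variables (R : realType) (n : nat).
Local Notation E := 'rV[R]_n.
Local Notation C := R[i].

(* iterated partial derivative along the directions listed in s *)
Definition partial (s : seq 'I_n) (u : E -> R) : E -> R :=
  foldr (fun j v x => 'D_(delta_mx 0 j) v x) u s.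

Definition partialC (s : seq 'I_n) (f : E -> C) : E -> C := fun x =>
  partial s (fun y => complex.Re (f y)) x +i*
  partial s (fun y => complex.Im (f y)) x.

(* membership in S(R^n) *)
Definition schwartz (f : E -> C) : Prop :=
  forall s : seq 'I_n,
    (forall x, differentiable (partial s (fun y => complex.Re (f y))) x) /\
    (forall x, differentiable (partial s (fun y => complex.Im (f y))) x) /\
    forall k : nat, exists M : R,
      forall x, `|x| ^+ k * Normc.normc (partialC s f x) <= M.

(* the increasing family of seminorms defining the topology of S(R^n) *)
Definition schwartz_seminorm (k : nat) (f : E -> C) : \bar R :=
  ereal_sup [set r : \bar R | exists (s : seq 'I_n) (m : nat) (x : E),
    [/\ (size s <= k)%N, (m <= k)%N &
        r = (`|x| ^+ m * Normc.normc (partialC s f x))%:E]].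

(* membership in S'(R^n).  A tempered distribution T is represented by a map
   on all functions, of which only the values at Schwartz functions count. *)
Definition tempered (T : (E -> C) -> C) : Prop :=
  (forall (a : C) (f g : E -> C), schwartz f -> schwartz g ->
     T (fun x => a * f x + g x) = a * T f + T g) /\
  exists (k : nat) (M : R), forall f, schwartz f ->
    ((Normc.normc (T f))%:E <= M%:E * schwartz_seminorm k f)%E.

Definition distr_nonzero (T : (E -> C) -> C) : Prop :=
  exists2 f, schwartz f & T f != 0.

End schwartz.

Section modulation.
Variables (R : realType) (hbar : R) (n : nat).
Local Notation E := 'rV[R]_n.
Local Notation C := R[i].

(* V_g T (x, xi); the integral against the distribution T is the pairing of T
   with the Schwartz function y |-> e^{-(i/hbar) xi.y} conj(g(y - x)). *)
Definition stft (g : E -> C) (T : (E -> C) -> C) (x xi : E) : C :=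
  ((2 * pi * hbar) `^ (- (n%:R / 2)))%:C *
  T (fun y => expi (- (dotv xi y / hbar)) * (g (y - x))^*).

Definition Minf1_norm (g : E -> C) (T : (E -> C) -> C) : \bar R :=
  integral_rV (fun xi =>
    ereal_sup [set (Normc.normc (stft g T x xi))%:E | x in [set: E]]).

Definition Minf1 : set ((E -> C) -> C) :=
  [set T | tempered T /\
    exists g, [/\ schwartz g, exists x, g x != 0 & (Minf1_norm g T < +oo)%E]].

(* l is the value of the oscillatory integral of e^{i|x|^2/(2 hbar)} against T:
   every regularization converges to l.  The integral of
   e^{i|x|^2/(2 hbar)} T(x) phi(eps x) is again a pairing of T with a Schwartz
   function; the prefactor is (2 pi i hbar)^{-n/2}. *)
Definition is_osc_integral (T : (E -> C) -> C) (l : C) : Prop :=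
  forall phi : E -> C, schwartz phi -> phi 0 = 1 ->
    (((2 * pi * hbar) `^ (- (n%:R / 2)))%:C * expi (- (pi * n%:R / 4)) *
      T (fun x => expi (dotv x x / (2 * hbar)) * phi (eps *: x)) : C^o)
    @[eps --> (0 : R)^'+] --> (l : C^o).

Definition osc_integral (T : (E -> C) -> C) : C :=
  xget 0 [set l | is_osc_integral T l].

(* operator norm of the oscillatory integral on M^{infty,1}(R^n), normed with
   the window g *)
Definition osc_opnorm (g : E -> C) : \bar R :=
  ereal_sup [set ((Normc.normc (osc_integral T))%:E / Minf1_norm g T)%E
            | T in [set T | Minf1 T /\ distr_nonzero T]].

Definition gauss_window (q : nat -> R) : E -> C := fun x =>
  ((2 * pi * hbar) `^ (- (n%:R / 2)) *
   expR (- (1 / (2 * hbar) * \sum_(j < n) q j * x 0 j ^+ 2)))%:C.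

End modulation.

(* Main.v *)
Require Import Defs.
From HB Require Import structures.
From mathcomp Require Import all_boot all_order all_algebra.
From mathcomp Require Import complex.
From mathcomp Require Import all_classical all_reals all_analysis.
From mathcomp Require Import measurable_realfun ring lra.
Import Order.TTheory GRing.Theory Num.Theory.
Import numFieldNormedType.Exports.
Local Open Scope classical_set_scope.
Local Open Scope ring_scope.

(* Write [h] for hbar and let [q] be one of the [q_j].  In one dimension, for
   [0 < s < q] and [p := q - s],

     [e^{(i - s) y^2 / 2h} e^{- (p + i) (y + xi)^2 / 2h}]

   is, as a function of [y], a constant of modulus at most 1 (depending on [xi])
   times the time-frequency shift of the window [e^{- q y^2 / 2h}] by [xi] in
   frequency and [- (1 - s / q) xi] in position (at [s = 0]: by [- xi]).
   Integrating over [xi] gives [F_q e^{(i - s) y^2 / 2h}], where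
   [F_q := \int e^{- (p + i) u^2 / 2h} du] has
   [|F_q|^2 = 2 pi h / sqrt (1 + p^2) >= 2 pi h e^{- 2 q^2}].
   Tensoring over the coordinates, the regularized chirp is an integral over [xi]
   of time-frequency shifts of [g_n], and pairing it with [T] yields
   [|L_n(T)| <= e^{q_1^2 + ... + q_n^2} ||T||], uniformly in [s] (that is, in
   the regularization parameter).

   The pairing is exchanged with the integral by means of Riemann sums over
   cubes, which converge in the Schwartz seminorms.  On each cube the integrand
   of [||T||] is at least the value of the pairing at a corner up to a Lipschitz
   error, hence it dominates a step function: no measurability of
   [xi |-> sup_x |V_g T (x, xi)|] is required. *)

(** * Complex-valued functions of a real variable: derivatives, mean value and Taylor bounds *)

Section complex_calculus.
Set Implicit Arguments.
Unset Strict Implicit.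
Variable R : realType.
Local Notation C := R[i].
Local Open Scope complex_scope.
Local Notation normc := (@Normc.normc R).
Local Notation Re := (@complex.Re R).
Local Notation Im := (@complex.Im R).
Implicit Types (x y z : C) (t u : R) (f g : R -> C).

Lemma complexRe_D x y : Re (x + y) = Re x + Re y.
Proof. by case: x y => ? ? []. Qed.

Lemma complexIm_D x y : Im (x + y) = Im x + Im y.
Proof. by case: x y => ? ? []. Qed.

Lemma complexRe_N x : Re (- x) = - Re x.
Proof. by case: x. Qed.

Lemma complexIm_N x : Im (- x) = - Im x.
Proof. by case: x. Qed.

Lemma complexRe_M x y : Re (x * y) = Re x * Re y - Im x * Im y.
Proof. by case: x y => ? ? []. Qed.

Lemma complexIm_M x y : Im (x * y) = Re x * Im y + Im x * Re y.
Proof. by case: x y => ? ? []. Qed.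

Lemma eq_complexP x y : Re x = Re y -> Im x = Im y -> x = y.
Proof. by case: x y => ? ? [? ?] /= -> ->. Qed.

Lemma normcE x : normc x = Num.sqrt (Re x ^+ 2 + Im x ^+ 2).
Proof. by case: x. Qed.

Lemma normc_ge0 x : 0 <= normc x.
Proof. by rewrite normcE sqrtr_ge0. Qed.

Lemma normc_sqr x : normc x ^+ 2 = Re x ^+ 2 + Im x ^+ 2.
Proof. by rewrite normcE sqr_sqrtr// addr_ge0// sqr_ge0. Qed.

Lemma ler_Re_normc x : `|Re x| <= normc x.
Proof.
by rewrite -sqrtr_sqr normcE ler_sqrt ?lerDl ?sqr_ge0// addr_ge0// sqr_ge0.
Qed.

Lemma ler_Im_normc x : `|Im x| <= normc x.
Proof.
by rewrite -sqrtr_sqr normcE ler_sqrt ?lerDr ?sqr_ge0// addr_ge0// sqr_ge0.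
Qed.

Lemma normc_leD x : normc x <= `|Re x| + `|Im x|.
Proof.
rewrite -[leRHS]ger0_norm ?addr_ge0// -sqrtr_sqr normcE ler_sqrt ?sqr_ge0//.
rewrite sqrrD !real_normK ?num_real// addrAC lerDl.
by rewrite mulrn_wge0// mulr_ge0.
Qed.

Lemma normc_real t : normc t%:C = `|t|.
Proof. by rewrite normcE /= expr0n addr0 sqrtr_sqr. Qed.

Lemma normc_expi t : normc (expi t) = 1.
Proof. by rewrite normcE /= cos2Dsin2 sqrtr1. Qed.

Lemma normc_sum (I : Type) (r : seq I) (P : pred I) (F : I -> C) :
  normc (\sum_(i <- r | P i) F i) <= \sum_(i <- r | P i) normc (F i).
Proof.
elim/big_rec2: _ => [|i a x _ ih]; first by rewrite Normc.normc0.
by apply: (le_trans (le_normcD _ _)); rewrite lerD2l.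
Qed.

Lemma normc_prod (I : Type) (r : seq I) (P : pred I) (F : I -> C) :
  normc (\prod_(i <- r | P i) F i) = \prod_(i <- r | P i) normc (F i).
Proof.
elim/big_rec2: _ => [|i a x _ ih]; first by rewrite Normc.normc1.
by rewrite Normc.normcM ih.
Qed.

Lemma expiD t u : expi (t + u) = expi t * expi u.
Proof.
by apply: eq_complexP; rewrite /= ?cosD ?sinD// addrC; congr (_ + _); rewrite mulrC.
Qed.

Lemma expi0 : expi (0 : R) = 1.
Proof. by rewrite /expi cos0 sin0. Qed.

Lemma expi_sum (I : Type) (r : seq I) (P : pred I) (F : I -> R) :
  expi (\sum_(i <- r | P i) F i) = \prod_(i <- r | P i) expi (F i).
Proof. by apply: (big_morph _ expiD expi0). Qed.

Definition is_derivC t f (d : C) : Prop :=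
  is_derive t 1 (fun u => Re (f u)) (Re d) /\
  is_derive t 1 (fun u => Im (f u)) (Im d).

Lemma is_derivC_eq t f d d' : is_derivC t f d -> d = d' -> is_derivC t f d'.
Proof. by move=> + <-. Qed.

Lemma is_derivC_cst t x : is_derivC t (fun=> x) 0.
Proof. by split; exact: is_derive_cst. Qed.

Lemma is_derivCD t f g df dg : is_derivC t f df -> is_derivC t g dg ->
  is_derivC t (fun u => f u + g u) (df + dg).
Proof.
move=> [f1 f2] [g1 g2]; split.
  under eq_fun do rewrite complexRe_D.
  by rewrite complexRe_D; exact: is_deriveD.
under eq_fun do rewrite complexIm_D.
by rewrite complexIm_D; exact: is_deriveD.
Qed.

Lemma is_derivCM t f g df dg : is_derivC t f df -> is_derivC t g dg ->
  is_derivC t (fun u => f u * g u) (df * g t + f t * dg).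
Proof.
move=> [f1 f2] [g1 g2]; split.
  under eq_fun do rewrite complexRe_M.
  apply: is_derive_eq (is_deriveB (is_deriveM f1 g1) (is_deriveM f2 g2)) _.
  rewrite !(complexRe_M, complexRe_D) /GRing.scale/=; ring.
under eq_fun do rewrite complexIm_M.
apply: is_derive_eq (is_deriveD (is_deriveM f1 g2) (is_deriveM f2 g1)) _.
rewrite !(complexIm_M, complexIm_D) /GRing.scale/=; ring.
Qed.

Lemma is_derivCZ t x f d : is_derivC t f d ->
  is_derivC t (fun u => x * f u) (x * d).
Proof.
move=> /(is_derivCM (is_derivC_cst t x)) /is_derivC_eq; apply.
by rewrite mul0r add0r.
Qed.

Lemma is_derivCN t f d : is_derivC t f d -> is_derivC t (fun u => - f u) (- d).
Proof.
move=> /(is_derivCZ (-1)); rewrite mulN1r => h.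
by under eq_fun do rewrite -mulN1r.
Qed.

Lemma is_derivC_sum t (I : Type) (r : seq I) (F : I -> R -> C) (dF : I -> C) :
  (forall i, is_derivC t (F i) (dF i)) ->
  is_derivC t (fun u => \sum_(i <- r) F i u) (\sum_(i <- r) dF i).
Proof.
move=> dFi; elim: r => [|i r ih].
  by rewrite big_nil; under eq_fun do rewrite big_nil; exact: is_derivC_cst.
by rewrite big_cons; under eq_fun do rewrite big_cons; exact: is_derivCD.
Qed.

Lemma is_derivC_real t (f : R -> R) d : is_derive t 1 f d ->
  is_derivC t (fun u => (f u)%:C) d%:C.
Proof. by move=> h; split => //=; exact: is_derive_cst. Qed.

Lemma is_derivC_id t : is_derivC t (fun u => u%:C) 1.
Proof. by apply: is_derivC_real; exact: is_derive_id. Qed.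

Lemma is_derivC_comp t (k : R -> R) dk f d : is_derive t 1 k dk ->
  is_derivC (k t) f d -> is_derivC t (fun u => f (k u)) (dk%:C * d).
Proof.
move=> hk [f1 f2].
split; (apply: is_derive_eq; first exact: is_derive1_comp).
  by rewrite complexRe_M /= mul0r subr0 mulrC.
by rewrite complexIm_M /= mul0r addr0 mulrC.
Qed.

Lemma is_derivC_shift t a f d : is_derivC (a + t) f d ->
  is_derivC t (fun u => f (a + u)) d.
Proof.
move=> h; apply: is_derivC_eq; first apply: (is_derivC_comp (dk := 1)) h.
  by apply: is_derive_eq; rewrite add0r.
by rewrite mul1r.
Qed.

Lemma is_derive_mean (f df : R -> R) (x y : R) :
  (forall u, is_derive u 1 f (df u)) -> x <= y ->
  exists2 c, x <= c <= y & f y - f x = df c * (y - x).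
Proof.
move=> hf xy.
have [|c + e] := @MVT_segment R f df x y xy (fun u _ => hf u).
  by apply: derivable_within_continuous => u _; apply: ex_derive.
by rewrite in_itv /= => cxy; exists c.
Qed.

(** The real mean value theorem applies to the real and imaginary parts at possibly different
    points; adding the two bounds costs the factor 2. *)
Lemma is_derivC_mean f df (x y B : R) :
  (forall u, is_derivC u f (df u)) -> (forall u, x <= u <= y -> normc (df u) <= B) ->
  x <= y -> normc (f y - f x) <= 2 * B * (y - x).
Proof.
move=> hf hB xy; apply: (le_trans (normc_leD _)).
rewrite complexRe_D complexIm_D complexRe_N complexIm_N.
have yx0 : 0 <= y - x by rewrite subr_ge0.
have [c cxy ->] := is_derive_mean (fun u => (hf u).1) xy.
have [d dxy ->] := is_derive_mean (fun u => (hf u).2) xy.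
rewrite !normrM (ger0_norm yx0) -mulrDl ler_wpM2r// mulr_natl mulr2n lerD//.
  exact: le_trans (ler_Re_normc _) (hB _ cxy).
exact: le_trans (ler_Im_normc _) (hB _ dxy).
Qed.

Lemma is_derivC_lipschitz f df (x y B : R) :
  (forall u, is_derivC u f (df u)) -> (forall u, normc (df u) <= B) ->
  normc (f x - f y) <= 2 * B * `|x - y|.
Proof.
move=> hf hB; wlog yx : x y / y <= x => [H|].
  have [|/ltW] := leP y x; first exact: H.
  by move=> /H; rewrite -normcN opprB distrC.
rewrite ger0_norm ?subr_ge0//.
by apply: (is_derivC_mean hf) => // u _.
Qed.

(** Two nested mean value bounds, each with its factor 2: one for the remainder $f(v) - v f'(x)$,
    one for its derivative $f'(u) - f'(x)$. *)
Lemma is_derivC_taylor1 f df d2f (x d B : R) :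
  (forall u, is_derivC u f (df u)) -> (forall u, is_derivC u df (d2f u)) ->
  (forall u, normc (d2f u) <= B) -> 0 <= d ->
  normc (f (x + d) - f x - d%:C * df x) <= 4 * B * d ^+ 2.
Proof.
move=> hf hdf hB d0.
have hg u : is_derivC u (fun v => f v - v%:C * df x) (df u - df x).
  apply: is_derivC_eq.
    apply: is_derivCD (hf u) _; apply: is_derivCN.
    by apply: is_derivCM (is_derivC_id u) (is_derivC_cst u _).
  by rewrite mul1r mulr0 addr0.
have -> : f (x + d) - f x - d%:C * df x =
    (f (x + d) - (x + d)%:C * df x) - (f x - x%:C * df x).
  by rewrite [(x + d)%:C]rmorphD/=; ring.
have xd : x <= x + d by rewrite lerDl.
have -> : 4 * B * d ^+ 2 = 2 * (2 * B * d) * ((x + d) - x) by ring.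
apply: (is_derivC_mean hg) => // u /andP[xu ux].
apply: (le_trans (is_derivC_mean (y := u) hdf (fun v _ => hB v) xu)).
rewrite ler_wpM2l//; last by lra.
by rewrite mulr_ge0// (le_trans (normc_ge0 _) (hB x)).
Qed.

End complex_calculus.

(** * Functions of one variable bundled with all their derivatives: complex Gaussians, products,
    weighted bounds *)

Section jets.
Set Implicit Arguments.
Unset Strict Implicit.
Variable R : realType.
Local Notation C := R[i].
Local Open Scope complex_scope.
Local Notation normc := (@Normc.normc R).
Local Notation Re := (@complex.Re R).
Local Notation Im := (@complex.Im R).
Implicit Types (z : C) (t u a : R) (F G H : nat -> R -> C).

(** The function $e^{-z u^2}$ for complex [z], in polar form. *)
Definition cgauss z u : C :=
  (expR (- (Re z * u ^+ 2)))%:C * expi (- (Im z * u ^+ 2)).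

Lemma normc_cgauss z u : normc (cgauss z u) = expR (- (Re z * u ^+ 2)).
Proof.
by rewrite Normc.normcM normc_expi mulr1 normc_real ger0_norm// expR_ge0.
Qed.

Lemma cgaussN z u : cgauss z (- u) = cgauss z u.
Proof. by rewrite /cgauss sqrrN. Qed.

Lemma cgauss0 z : cgauss z 0 = 1.
Proof. by rewrite /cgauss expr0n /= !mulr0 !oppr0 expR0 expi0 mulr1. Qed.

Lemma is_derivC_expi t : is_derivC t (@expi R) ('i%C * expi t).
Proof.
split; first by apply: is_derive_eq; rewrite complexRe_M /= mul0r sub0r mul1r.
by apply: is_derive_eq; rewrite complexIm_M /= mul0r add0r mul1r.
Qed.

Lemma is_derivC_cgauss z u :
  is_derivC u (cgauss z) (- (2 * z * u%:C) * cgauss z u).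
Proof.
have hk (b : R) : is_derive u 1 (fun v : R => - (b * v ^+ 2)) (- (2 * b * u)).
  by apply: is_derive_eq; rewrite /GRing.scale /=; ring.
have he := @is_derive1_comp _ expR _ _ _ _ (is_derive_expR _) (hk (Re z)).
have hi := is_derivC_comp (hk (Im z)) (is_derivC_expi _).
apply: is_derivC_eq (is_derivCM (is_derivC_real he) hi) _.
rewrite /cgauss [(expR \o _) u]/=; move: (expR _) (expi _) => e w.
have -> : (e * - (2 * Re z * u))%:C = e%:C * - (2 * (Re z)%:C * u%:C).
  by rewrite !(rmorphM, rmorphN, rmorph_nat) /=; ring.
have -> : (- (2 * Im z * u))%:C = - (2 * (Im z)%:C * u%:C).
  by rewrite !(rmorphM, rmorphN, rmorph_nat) /=; ring.
by rewrite [in RHS](complexE z); ring.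
Qed.

(** [F k] plays the role of the [k]-th derivative of [F 0], so that derivatives of all orders have
    explicit names and bounds. *)
Definition is_jet F := forall k t, is_derivC t (F k) (F k.+1 t).

(** Derivatives of $f = e^{-z u^2}$: differentiating $f' = -2 z u f$ [k] times gives $f^{(k+1)} =
    -2z (u f^{(k)} + k f^{(k-1)})$, the recurrence of the Hermite functions. *)
Fixpoint gjet z k u : C :=
  if k is k'.+1 then
    - (2 * z) * (u%:C * gjet z k' u +
                 if k' is k''.+1 then k'%:R * gjet z k'' u else 0)
  else cgauss z u.

Lemma gjetSS z k u : gjet z k.+2 u =
  - (2 * z) * (u%:C * gjet z k.+1 u + k.+1%:R * gjet z k u).
Proof. by []. Qed.

Lemma gjet_is_jet z : is_jet (gjet z).
Proof.
(* The recurrence has depth two, so the induction carries two consecutive orders. *)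
suff h k : (forall t, is_derivC t (gjet z k) (gjet z k.+1 t)) /\
           (forall t, is_derivC t (gjet z k.+1) (gjet z k.+2 t)).
  by move=> k t; exact: (h k).1.
elim: k => [|k [ih1 ih2]].
  have h0 t : is_derivC t (gjet z 0) (gjet z 1 t).
    by apply: is_derivC_eq (is_derivC_cgauss z t) _; rewrite /= addr0; ring.
  split=> // t.
  have -> : gjet z 1 = fun u => - (2 * z) * (u%:C * gjet z 0 u).
    by apply/funext => u /=; rewrite addr0.
  apply: is_derivC_eq.
    by apply: is_derivCZ; exact: is_derivCM (is_derivC_id t) (h0 t).
  by rewrite gjetSS; ring.
split=> // t; apply: is_derivC_eq.
  apply: is_derivCZ; apply: is_derivCD; last exact: is_derivCZ (ih1 t).
  exact: is_derivCM (is_derivC_id t) (ih2 t).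
by rewrite [RHS]gjetSS -[in RHS]natr1; ring.
Qed.

Definition jet_shift a F k t := F k (a + t).

Lemma is_jet_shift a F : is_jet F -> is_jet (jet_shift a F).
Proof. by move=> jF k t; exact: is_derivC_shift (jF k (a + t)). Qed.

Definition decays F :=
  forall k m, exists B : R, forall u, (1 + `|u|) ^+ m * normc (F k u) <= B.

Lemma decays_cgauss z m : 0 < Re z ->
  exists B : R, forall u, (1 + `|u|) ^+ m * normc (cgauss z u) <= B.
Proof.
move=> z0; case: m => [|m].
  exists 1 => u; rewrite expr0 mul1r normc_cgauss -expR0 ler_expR oppr_le0.
  by rewrite mulr_ge0 ?sqr_ge0// ltW.
(* With this [c] the Gaussian is the [m.+1]-th power of $e^{-c u^2}$, so a bound on $(1 + |u|) e^{-c
   u^2}$ suffices; $2 + 1/c$ is one, because $e^x \ge 1 + x$. *)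
pose c := Re z / m.+1%:R; have c0 : 0 < c by rewrite divr_gt0.
exists ((2 + c^-1) ^+ m.+1) => u; rewrite normc_cgauss.
have -> : - (Re z * u ^+ 2) = m.+1%:R * - (c * u ^+ 2).
  by rewrite mulrN [in RHS]mulrA [m.+1%:R * c]mulrC divfK.
rewrite expRM_natl -exprMn lerXn2r ?nnegrE ?mulr_ge0 ?expR_ge0 ?addr_ge0 ?invr_ge0 ?(ltW c0)//.
rewrite expRN ler_pdivrMr ?expR_gt0//.
apply: (@le_trans _ _ ((2 + c^-1) * (1 + c * u ^+ 2))); last first.
  by rewrite ler_wpM2l ?expR_ge1Dx// addr_ge0// invr_ge0 ltW.
have -> : (2 + c^-1) * (1 + c * u ^+ 2) =
    2 + c^-1 + 2 * c * u ^+ 2 + (c^-1 * c) * u ^+ 2 by ring.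
rewrite mulVf ?gt_eqF// mul1r -[u ^+ 2]real_normK ?num_real//.
have : 0 < c^-1 by rewrite invr_gt0.
have : 0 <= 2 * c * `|u| ^+ 2.
  by apply: mulr_ge0; [rewrite mulr_ge0// ltW|exact: sqr_ge0].
have := sqr_ge0 (`|u| - 1); nra.
Qed.

(** In the recurrence, the multiplication by [u] is absorbed by one more power of the weight. *)
Lemma decays_gjet z : 0 < Re z -> decays (gjet z).
Proof.
move=> z0; suff h k : (forall m, exists B : R, forall u,
      (1 + `|u|) ^+ m * normc (gjet z k u) <= B) /\ (forall m, exists B : R,
    forall u, (1 + `|u|) ^+ m * normc (gjet z k.+1 u) <= B).
  by move=> k; exact: (h k).1.
have step i x m : (forall m, exists B : R, forall u,
      (1 + `|u|) ^+ m * normc (gjet z i u) <= B) ->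
    (exists B : R, forall u, (1 + `|u|) ^+ m * normc (x u) <= B) ->
    exists B : R, forall u, (1 + `|u|) ^+ m * normc
      (- (2 * z) * (u%:C * gjet z i u + x u)) <= B.
  move=> /(_ m.+1)[B1 hB1] [B2 hB2].
  exists (normc (- (2 * z)) * (B1 + B2)) => u.
  rewrite Normc.normcM mulrCA ler_wpM2l ?normc_ge0//.
  apply: (le_trans _ (lerD (hB1 u) (hB2 u))).
  have u1 : 0 <= (1 + `|u|) ^+ m by rewrite exprn_ge0// addr_ge0.
  rewrite exprSr -mulrA -mulrDr ler_wpM2l//.
  apply: (le_trans (le_normcD _ _)); rewrite lerD2r Normc.normcM normc_real.
  by rewrite ler_wpM2r ?normc_ge0// lerDr.
elim: k => [|k [ih1 ih2]]; split=> // m.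
- exact: decays_cgauss.
- apply: (step 0%N (fun=> 0)) => [m'|]; first exact: decays_cgauss.
  by exists 0 => u; rewrite Normc.normc0 mulr0.
- apply: (step k.+1 (fun u => k.+1%:R * gjet z k u)) => //.
  have [B hB] := ih1 m; exists (normc (k.+1%:R) * B) => u.
  by rewrite Normc.normcM mulrCA ler_wpM2l ?normc_ge0.
Qed.

Lemma decays_bounded F : decays F -> forall n, exists2 B : R, 0 <= B &
  forall k m u, (k <= n)%N -> (m <= n)%N -> (1 + `|u|) ^+ m * normc (F k u) <= B.
Proof.
move=> dF n.
have {dF} h k : exists2 B : R, 0 <= B & forall m u, (m <= n)%N ->
    (1 + `|u|) ^+ m * normc (F k u) <= B.
  have [B hB] := dF k n; exists B => [|m u mn].
    apply: le_trans (hB 0); apply: mulr_ge0 (normc_ge0 _).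
    by rewrite exprn_ge0// addr_ge0.
  apply: le_trans (hB u); rewrite ler_wpM2r ?normc_ge0//.
  by rewrite ler_weXn2l// lerDl.
suff: forall p, exists2 B : R, 0 <= B & forall k m u, (k <= p)%N ->
    (m <= n)%N -> (1 + `|u|) ^+ m * normc (F k u) <= B by [].
elim=> [|p [B1 B10 hB1]].
  have [B B0 hB] := h 0%N; exists B => // k m u; rewrite leqn0 => /eqP ->.
  exact: hB.
have [B2 B20 hB2] := h p.+1.
exists (B1 + B2) => [|k m u]; first exact: addr_ge0.
rewrite leq_eqVlt => /predU1P[->|kp] mn.
  by apply: (le_trans (hB2 _ _ mn)); rewrite lerDr.
by apply: (le_trans (hB1 _ _ _ kp mn)); rewrite lerDl.
Qed.

(** The Leibniz rule as a binary tree: each derivative falls on the left or on the right factor.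
    Binomial coefficients are replaced by $2^k$ leaves, which is where the constants $2^k$ below
    come from. *)
Fixpoint jet_mul_rec k F G t : C :=
  if k is k'.+1 then
    jet_mul_rec k' (fun i => F i.+1) G t + jet_mul_rec k' F (fun i => G i.+1) t
  else F 0%N t * G 0%N t.

Definition jet_mul F G k t := jet_mul_rec k F G t.

Lemma is_jet_mul F G : is_jet F -> is_jet G -> is_jet (jet_mul F G).
Proof.
move=> jF jG k; elim: k F G jF jG => [|k ih] F G jF jG t.
  exact: is_derivCM (jF _ _) (jG _ _).
apply: is_derivCD; [apply: (ih (fun i => F i.+1))|apply: (ih F)] => //.
Qed.

Lemma jet_mulB F G H k t : jet_mul F (fun i u => G i u - H i u) k t =
  jet_mul F G k t - jet_mul F H k t.
Proof.
rewrite /jet_mul; elim: k F G H => [|k ih] F G H /=; first by rewrite mulrBr.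
by rewrite ih (ih F (fun i => G i.+1)) addrACA opprD.
Qed.

Lemma normc_jet_mul F G k t (A B : R) :
  (forall i, (i <= k)%N -> normc (F i t) <= A) ->
  (forall i, (i <= k)%N -> normc (G i t) <= B) ->
  normc (jet_mul F G k t) <= 2 ^+ k * (A * B).
Proof.
rewrite /jet_mul; elim: k F G => [|k ih] F G hF hG /=.
  by rewrite expr0 mul1r Normc.normcM ler_pM ?normc_ge0 ?hF ?hG.
apply: (le_trans (le_normcD _ _)); rewrite exprS -mulrA mulr_natl mulr2n lerD//.
  by apply: ih => i ik; [exact: hF|apply: hG; exact: leqW].
by apply: ih => i ik; [apply: hF; exact: leqW|exact: hG].
Qed.

Definition jet_bound k (B : R) F :=
  forall i t, (i <= k)%N -> (1 + `|t|) ^+ k * normc (F i t) <= B.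

(** The first factor carries the whole weight; the second one only has to be bounded. This makes
    estimates uniform over translates of the second factor. *)
Lemma jet_bound_mul k (A B : R) F G : jet_bound k A F ->
  (forall i t, (i <= k)%N -> normc (G i t) <= B) ->
  jet_bound k (2 ^+ k * (A * B)) (jet_mul F G).
Proof.
move=> hF hG i t ik.
have w0 : 0 < (1 + `|t|) ^+ k by rewrite exprn_gt0// ltr_pwDl.
rewrite mulrC -ler_pdivlMr//.
have -> : 2 ^+ k * (A * B) / (1 + `|t|) ^+ k =
  2 ^+ k * (A / (1 + `|t|) ^+ k * B) by rewrite -!mulrA; do 2!congr *%R; rewrite mulrC.
have A0 : 0 <= A / (1 + `|t|) ^+ k.
  rewrite ler_pdivlMr// mul0r; apply: le_trans (hF 0%N t _) => //.
  by rewrite mulr_ge0 ?normc_ge0// ltW.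
have B0 : 0 <= B by exact: le_trans (normc_ge0 _) (hG 0%N t _).
apply: (@le_trans _ _ (2 ^+ i * (A / (1 + `|t|) ^+ k * B))).
  apply: normc_jet_mul => j ji; last by apply: hG; exact: leq_trans ik.
  by rewrite ler_pdivlMr// mulrC; apply: hF; exact: leq_trans ik.
by rewrite ler_wpM2r ?(mulr_ge0 A0 B0)// ler_weXn2l// ler1n.
Qed.

End jets.

(** * The complex Gaussian integral over a half-line: convergence rate and modulus *)

Section fresnel.
Set Implicit Arguments.
Unset Strict Implicit.
Variable R : realType.
Local Notation C := R[i].
Local Open Scope complex_scope.
Local Notation normc := (@Normc.normc R).
Local Notation Re := (@complex.Re R).
Local Notation Im := (@complex.Im R).
Local Notation mu := (@lebesgue_measure R).
Implicit Types (z : C) (t u x a : R) (f g : R -> C).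

Lemma integrable01 (f : R -> R) : continuous f ->
  mu.-integrable `[0, 1] (EFin \o f).
Proof.
move=> cf; apply: continuous_compact_integrable; first exact: segment_compact.
exact: continuous_subspaceT.
Qed.

Lemma is_derive_integral01 (f f1 : R -> R -> R) (c M : R) :
  (forall u x, is_derive u 1 (f^~ x) (f1 u x)) ->
  (forall u, continuous (f u)) ->
  (forall u x, c - 1 < u < c + 1 -> 0 <= x <= 1 -> `|f1 u x| <= M) ->
  is_derive c 1 (fun u => \int[mu]_(x in `[0, 1]) f u x)
    (\int[mu]_(x in `[0, 1]) f1 c x).
Proof.
move=> df cf hM.
have Ic : `]c - 1, c + 1[%classic c by rewrite /= in_itv /= ltrDl ltrBlDr ltrDl ltr01.
have intf u : `]c - 1, c + 1[%classic u -> mu.-integrable `[0, 1] (EFin \o f u).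
  by move=> _; exact: integrable01.
have d1f u x : partial1of2 f u x = f1 u x.
  by rewrite partial1of2E; apply: derive_val.
have derf u x : `]c - 1, c + 1[%classic u -> `[0, 1]%classic x ->
    derivable (f^~ x) u 1 by move=> _ _; exact: ex_derive.
have M0 : 0 <= M.
  apply: le_trans (normr_ge0 _) (hM c 0 _ _); last by rewrite lexx ler01.
  by have := Ic; rewrite /= in_itv.
have intM : mu.-integrable `[0, 1] (EFin \o (fun=> M)).
  by apply: integrable01 => ?; exact: cvg_cst.
have ubM u x : `]c - 1, c + 1[%classic u -> `[0, 1]%classic x ->
    `|partial1of2 f u x| <= M.
  by rewrite /= !in_itv /= d1f => hu hx; exact: hM.
apply: DeriveDef.
  by apply: (@derivable_under_integral R _ _ mu f `[0, 1] _ c (c - 1) (c + 1)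
    Ic intf derf (fun=> M)).
rewrite -derive1E.
rewrite (@differentiation_under_integral R _ _ mu f `[0, 1] _ c (c - 1) (c + 1)
    Ic intf derf (fun=> M))//.
by apply: eq_Rintegral => x _; rewrite d1f.
Qed.

Definition contC f := continuous (fun u => Re (f u)) /\ continuous (fun u => Im (f u)).

Lemma is_derivC_contC f df : (forall u, is_derivC u f (df u)) -> contC f.
Proof.
move=> h; split => u; apply: differentiable_continuous;
  apply/derivable1_diffP; have [h1 h2] := h u; exact: ex_derive.
Qed.

Lemma contCM f g : contC f -> contC g -> contC (fun u => f u * g u).
Proof.
move=> [f1 f2] [g1 g2]; split.
  under eq_fun do rewrite complexRe_M.
  move=> u; apply: cvgB; apply: cvgM; by [exact: f1|exact: f2|exact: g1|exact: g2].
under eq_fun do rewrite complexIm_M.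
move=> u; apply: cvgD; apply: cvgM; by [exact: f1|exact: f2|exact: g1|exact: g2].
Qed.

Lemma contCD f g : contC f -> contC g -> contC (fun u => f u + g u).
Proof.
move=> [f1 f2] [g1 g2]; split.
  by under eq_fun do rewrite complexRe_D; move=> u; apply: cvgD; [exact: f1|exact: g1].
by under eq_fun do rewrite complexIm_D; move=> u; apply: cvgD; [exact: f2|exact: g2].
Qed.

Lemma contC_real (f : R -> R) : continuous f -> contC (fun u => (f u)%:C).
Proof. by move=> cf; split => //= u; exact: cvg_cst. Qed.

Definition cint01 f : C :=
  (\int[mu]_(x in `[0, 1]) Re (f x)) +i* (\int[mu]_(x in `[0, 1]) Im (f x)).

Lemma cint01Z z f : contC f -> cint01 (fun x => z * f x) = z * cint01 f.
Proof.
move=> [f1 f2].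
have i1 := integrable01 f1; have i2 := integrable01 f2.
have iZ (r : R) (h : R -> R) : continuous h ->
    mu.-integrable `[0, 1] (EFin \o (fun x => r * h x)).
  by move=> ch; apply: integrable01 => x; apply: cvgM; [exact: cvg_cst|exact: ch].
apply: eq_complexP; rewrite /cint01 /= ?(complexRe_M, complexIm_M) /=.
  under eq_Rintegral do rewrite complexRe_M.
  by rewrite RintegralB ?RintegralZl//; exact: iZ.
under eq_Rintegral do rewrite complexIm_M.
by rewrite RintegralD ?RintegralZl//; exact: iZ.
Qed.

Lemma normr_integral01 (f : R -> R) (B : R) : continuous f ->
  (forall x, 0 <= x <= 1 -> `|f x| <= B) ->
  `|\int[mu]_(x in `[0, 1]) f x| <= B.
Proof.
move=> cf hB; apply: le_trans (le_normr_Rintegral _ _) _ => //.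
  exact: integrable01.
have -> : B = \int[mu]_(x in `[0, 1]) B.
  by rewrite Rintegral_cst//= lebesgue_measure_itv//= lte01 oppr0 addr0 mulr1.
apply: le_Rintegral => //.
- by apply: integrable01 => x; apply: cvg_norm; exact: cf.
- by apply: integrable01 => x; exact: cvg_cst.
Qed.

Lemma normc_cint01 f (B : R) : contC f ->
  (forall x, 0 <= x <= 1 -> normc (f x) <= B) -> normc (cint01 f) <= 2 * B.
Proof.
move=> [f1 f2] hB; apply: (le_trans (normc_leD _)).
rewrite mulr_natl mulr2n lerD//; apply: normr_integral01 => // x hx.
  exact: le_trans (ler_Re_normc _) (hB x hx).
exact: le_trans (ler_Im_normc _) (hB x hx).
Qed.

Lemma is_derivC_cint01 (f f1 : R -> R -> C) (c M : R) :
  (forall u x, is_derivC u (f^~ x) (f1 u x)) ->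
  (forall u, contC (f u)) ->
  (forall u x, c - 1 < u < c + 1 -> 0 <= x <= 1 -> normc (f1 u x) <= M) ->
  is_derivC c (fun u => cint01 (f u)) (cint01 (f1 c)).
Proof.
move=> df cf hM; split => /=.
  apply: (is_derive_integral01 (f := fun u x => Re (f u x))
    (f1 := fun u x => Re (f1 u x)) (M := M)).
  - by move=> u x; exact: (df u x).1.
  - by move=> u; exact: (cf u).1.
  - by move=> u x hu hx; exact: le_trans (ler_Re_normc _) (hM u x hu hx).
apply: (is_derive_integral01 (f := fun u x => Im (f u x))
  (f1 := fun u x => Im (f1 u x)) (M := M)).
- by move=> u x; exact: (df u x).2.
- by move=> u; exact: (cf u).2.
- by move=> u x hu hx; exact: le_trans (ler_Im_normc _) (hM u x hu hx).
Qed.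

Lemma integral01_FTC (f F : R -> R) : continuous f ->
  (forall x, is_derive x 1 F (f x)) ->
  \int[mu]_(x in `[0, 1]) f x = F 1 - F 0.
Proof.
move=> cf dF.
have cF : continuous F.
  move=> x; apply: differentiable_continuous; apply/derivable1_diffP.
  exact: ex_derive.
rewrite /Rintegral (@continuous_FTC2 _ f F)//.
- exact: continuous_subspaceT.
- split; first by move=> x _; exact: ex_derive.
    by apply: cvg_at_right_filter; exact: cF.
  by apply: cvg_at_left_filter; exact: cF.
- by move=> x _; rewrite derive1E; apply: derive_val.
Qed.

Lemma cint01_FTC f F : contC f -> (forall x, is_derivC x F (f x)) ->
  cint01 f = F 1 - F 0.
Proof.
move=> [f1 f2] dF.
apply: eq_complexP; rewrite /= ?(complexRe_D, complexIm_D, complexRe_N, complexIm_N).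
  by apply: (integral01_FTC (F := fun x => Re (F x))) => // x; exact: (dF x).1.
by apply: (integral01_FTC (F := fun x => Im (F x))) => // x; exact: (dF x).2.
Qed.

Lemma normc_cgauss_le1 z u : 0 < Re z -> normc (cgauss z u) <= 1.
Proof.
move=> z0; rewrite normc_cgauss -expR0 ler_expR oppr_le0.
by rewrite mulr_ge0 ?sqr_ge0// ltW.
Qed.

Lemma is_derive_mull u x : is_derive x 1 (fun v => u * v) u.
Proof. by apply: is_derive_eq; rewrite /GRing.scale /= ?mulr1 ?mulr0 ?addr0. Qed.

Lemma is_derivC_cgaussM z x u :
  is_derivC u (fun v => cgauss z (v * x)) (x%:C * gjet z 1 (u * x)).
Proof.
have hx : is_derive u 1 (fun v => v * x) x.
  by under eq_fun do rewrite mulrC; exact: is_derive_mull.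
exact: is_derivC_comp hx (gjet_is_jet z 0 (u * x)).
Qed.

Lemma is_derivC_cgaussMl z u x :
  is_derivC x (fun y => cgauss z (u * y)) (u%:C * gjet z 1 (u * x)).
Proof.
under eq_fun do rewrite mulrC.
by rewrite (mulrC u x); exact: is_derivC_cgaussM.
Qed.

Lemma contC_cgaussMl z u : contC (fun x => cgauss z (u * x)).
Proof. exact: is_derivC_contC (is_derivC_cgaussMl z u). Qed.

(* The antiderivative of [cgauss z] vanishing at [0], in a form which does not
   depend on the sign of [u]. *)
Definition fprim z u := cint01 (fun x => u%:C * cgauss z (u * x)).

Lemma fprimN z u : fprim z (- u) = - fprim z u.
Proof.
rewrite /fprim !cint01Z; try exact: contC_cgaussMl.
rewrite rmorphN mulNr; congr (- (_ * cint01 _)).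
by apply/funext => x; rewrite mulNr cgaussN.
Qed.

(** Differentiating the integrand $u e^{-z u^2 x^2}$ in $u$ gives the $x$-derivative of $x e^{-z u^2
    x^2}$, which integrates to $e^{-z u^2}$ over the unit interval. *)
Lemma is_derivC_fprim z u : 0 < Re z -> is_derivC u (fprim z) (cgauss z u).
Proof.
move=> z0; have [B B0 hB] := decays_bounded (decays_gjet z0) 1%N.
pose f1 v x : C := cgauss z (v * x) + (v * x)%:C * gjet z 1 (v * x).
have cf1 x : is_derivC x (fun x => x%:C * cgauss z (u * x)) (f1 u x).
  apply: is_derivC_eq (is_derivCM (is_derivC_id x) (is_derivC_cgaussMl z u x)) _.
  by rewrite /f1 rmorphM /=; ring.
have cf : contC (f1 u).
  apply: contCD; first exact: contC_cgaussMl.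
  apply: contCM; first by apply: contC_real; exact: mulrl_continuous.
  apply: is_derivC_contC => y.
  exact: is_derivC_comp (is_derive_mull u y) (gjet_is_jet z 1 _).
have <- : cint01 (f1 u) = cgauss z u.
  by rewrite (cint01_FTC cf cf1) mulr1 mul1r mul0r subr0.
apply: (is_derivC_cint01 (f := fun u x => u%:C * cgauss z (u * x)) (M := B + B)).
- move=> v x.
  apply: is_derivC_eq (is_derivCM (is_derivC_id v) (is_derivC_cgaussM z x v)) _.
  by rewrite /f1 rmorphM /=; ring.
- move=> v; apply: (contCM (f := fun=> v%:C)); last exact: contC_cgaussMl.
  by apply: contC_real => ?; exact: cvg_cst.
move=> v x _ _; apply: (le_trans (le_normcD _ _)); apply: lerD.
  by have := hB 0%N 0%N (v * x) isT isT; rewrite expr0 mul1r.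
rewrite Normc.normcM normc_real.
have := hB 1%N 1%N (v * x) isT isT; rewrite expr1.
by apply: le_trans; rewrite ler_wpM2r ?normc_ge0// lerDr.
Qed.

(** This is $\int_0^1 e^{-z u^2 (1 + x^2)} / (1 + x^2) dx$. *)
Let faux z u :=
  cint01 (fun x => cgauss z u * (cgauss z (u * x) * ((oneDsqr x)^-1)%:C)).

Let contC_oneDsqrV : contC (fun x => ((oneDsqr x)^-1)%:C).
Proof. by apply: contC_real; exact: continuous_oneDsqrV. Qed.

Let contC_faux z u : contC (fun x => cgauss z (u * x) * ((oneDsqr x)^-1)%:C).
Proof. by apply: contCM => //; exact: contC_cgaussMl. Qed.

(** The derivative of the exponent in $u$ produces the factor $1 + x^2$, which cancels the
    denominator. *)
Let is_derivC_faux z u : 0 < Re z ->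
  is_derivC u (faux z) (- (2 * z * cgauss z u) * fprim z u).
Proof.
move=> z0.
rewrite /fprim -cint01Z; last first.
  apply: (contCM (f := fun=> u%:C)); last exact: contC_cgaussMl.
  by apply: contC_real => ?; exact: cvg_cst.
pose M := normc (2 * z) * (`|u| + 1).
apply: (is_derivC_cint01 (M := M)
  (f1 := fun u x => - (2 * z * cgauss z u) * (u%:C * cgauss z (u * x)))).
- move=> v x; apply: is_derivC_eq.
    apply: is_derivCM; first exact: (gjet_is_jet z 0 v).
    by apply: is_derivCM (is_derivC_cst v _); exact: is_derivC_cgaussM.
  rewrite mulr0 addr0 /= !addr0.
  have h : (1 + x%:C ^+ 2) * ((oneDsqr x)^-1)%:C = 1.
    have -> : 1 + x%:C ^+ 2 = (oneDsqr x)%:C.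
      by rewrite [RHS]rmorphD rmorphXn rmorph1.
    by rewrite -rmorphM mulfV.
  rewrite rmorphM /=.
  rewrite -[RHS]mulr1 -h; ring.
- by move=> v; apply: (contCM (f := fun=> cgauss z v)) => //; split => ?; exact: cvg_cst.
move=> v x /andP[v1 v2] _.
rewrite /M mulNr normcN -(mulrA (2 * z)) Normc.normcM ler_wpM2l ?normc_ge0//.
have hv : `|v| <= `|u| + 1.
  by rewrite -lerBlDl (le_trans (lerB_dist _ _))// ler_distl ltW//= ltW.
apply: (@le_trans _ _ (1 * (`|v| * 1))); last by rewrite mul1r mulr1.
rewrite Normc.normcM [normc (v%:C * _)]Normc.normcM normc_real.
have h1 w : normc (cgauss z w) <= 1 by exact: normc_cgauss_le1.
have h0 w : 0 <= normc (cgauss z w) by exact: normc_ge0.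
by apply: ler_pM => //; [exact: mulr_ge0|exact: ler_wpM2l].
Qed.

(* [z fprim^2] and [faux] have opposite derivatives: Laplace's evaluation of the
   Gaussian integral, valid as it stands for complex [z]. *)
Let fprim_sqr z u : 0 < Re z -> z * fprim z u ^+ 2 = (pi / 4)%:C - faux z u.
Proof.
move=> z0; pose H v : C := z * (fprim z v * fprim z v) + faux z v.
have dH v : is_derivC v H 0.
  apply: is_derivC_eq.
    apply: is_derivCD (is_derivC_faux v z0); apply: is_derivCZ.
    by apply: is_derivCM; exact: is_derivC_fprim.
  by ring.
(* At 0, [fprim] vanishes and [faux] is $\int_0^1 dx / (1 + x^2) = \arctan 1$. *)
have H0 : H 0 = (pi / 4)%:C.
  rewrite /H /fprim cint01Z; last exact: contC_cgaussMl.
  rewrite !mul0r mulr0 add0r /faux cint01Z ?cgauss0 ?mul1r//.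
  under eq_fun do rewrite mul0r cgauss0 mul1r.
  by apply: eq_complexP; rewrite /= ?integral0_oneDsqr ?atan1// Rintegral_cst ?mul0r.
have B0 (v : R) : normc 0 <= 0 by rewrite Normc.normc0.
have := is_derivC_lipschitz u 0 dH B0; rewrite mulr0 mul0r => hu.
have /Normc.eq0_normc/eqP : normc (H u - H 0) = 0.
  by apply/eqP; rewrite eq_le hu normc_ge0.
by rewrite H0 subr_eq0 => /eqP <-; rewrite /H addrK expr2.
Qed.

Let normc_faux z u : 0 < Re z -> normc (faux z u) <= 2 * normc (cgauss z u).
Proof.
move=> z0; apply: normc_cint01.
  by apply: (contCM (f := fun=> cgauss z u)) => //; split => ?; exact: cvg_cst.
move=> x _; rewrite Normc.normcM ler_piMr ?normc_ge0// Normc.normcM normc_real.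
have h : `|(oneDsqr x)^-1| <= 1.
  by rewrite ger0_norm ?invr_ge0//; exact: oneDsqrV_le1.
rewrite -[leRHS]mulr1 ler_pM ?normc_ge0//; exact: normc_cgauss_le1.
Qed.

(** The Archimedean form in which limits are taken below: an inequality that holds up to an error of
    order $1/(n+1)$ for every $n$ holds exactly. *)
Lemma le0_div_nat (x K : R) : (forall n : nat, x <= K / n.+1%:R) -> x <= 0.
Proof.
move=> h; have [//|x0] := leP x 0.
have K0 : 0 < K by have := h 0%N; rewrite divr1; exact: lt_le_trans.
have /ltr_add_invr [n] : 0 < x / K by rewrite divr_gt0.
rewrite add0r ltr_pdivlMr// mulrC => hn.
by have := lt_le_trans hn (h n); rewrite ltxx.
Qed.

(** Nested intervals: each lower estimate $f(v) - B/(1+v)$ is below each upper estimate $f(u) +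
    B/(1+u)$, and the limit is the supremum of the lower ones. *)
Lemma exists_limit_rate (f : R -> R) (B : R) :
  (forall u v, 0 <= u <= v -> `|f v - f u| <= B / (1 + u)) ->
  exists l, forall u, 0 <= u -> `|f u - l| <= B / (1 + u).
Proof.
move=> hf.
have hub u v : 0 <= u -> 0 <= v -> f v - B / (1 + v) <= f u + B / (1 + u).
  move=> u0 v0; have B0 w : 0 <= w -> 0 <= B / (1 + w).
    by move=> w0; apply: le_trans (normr_ge0 _) (hf w w _); rewrite w0 lexx.
  have := B0 _ u0; have := B0 _ v0; have [uv|/ltW vu] := leP u v.
    by have := hf u v; rewrite u0 uv => /(_ isT); rewrite ler_norml; lra.
  by have := hf v u; rewrite v0 vu => /(_ isT); rewrite ler_norml; lra.
pose A := [set f v - B / (1 + v) | v in [set v | 0 <= v]].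
have A0 : A !=set0 by exists (f 0 - B / (1 + 0)); exists 0 => //=.
have Aub u : 0 <= u -> ubound A (f u + B / (1 + u)).
  by move=> u0 _ [v /= v0 <-]; exact: hub.
exists (sup A) => u u0; rewrite distrC ler_distl; apply/andP; split.
  by apply: ub_le_sup; [exists (f u + B / (1 + u)); exact: Aub|exists u].
by apply: ge_sup => //; exact: Aub.
Qed.

(** The functions $f + B e^{-w}$ and $f - B e^{-w}$ are monotone in opposite directions, so [f]
    varies by at most $B e^{-u} \le B/(1+u)$ beyond [u]. *)
Lemma is_derive_exp_rate (f df : R -> R) (B u v : R) :
  (forall w : R, is_derive w 1 f (df w)) -> (forall w, `|df w| <= B * expR (- w)) ->
  0 <= u <= v -> `|f v - f u| <= B / (1 + u).
Proof.
move=> hf hB /andP[u0 uv].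
have dE (c w : R) : is_derive w 1 (fun w => f w + c * expR (- w))
    (df w - c * expR (- w)).
  have hE : is_derive w 1 (fun w : R => expR (- w)) (expR (- w) * - 1).
    exact: (@is_derive1_comp _ expR -%R).
  have hc : is_derive w 1 (fun w : R => c * expR (- w)) (c * (expR (- w) * -1)).
    exact: (is_deriveZ (c : R^o) hE).
  by apply: is_derive_eq (is_deriveD (hf w) hc) _; ring.
have uv0 : 0 <= v - u by rewrite subr_ge0.
have B0 : 0 <= B by have := le_trans (normr_ge0 _) (hB 0); rewrite oppr0 expR0 mulr1.
have hexp : B * expR (- u) <= B / (1 + u).
  rewrite ler_wpM2l// expRN lef_pV2 ?posrE ?expR_gt0 ?expR_ge1Dx//.
  by rewrite ltr_pwDl.
have Bv : 0 <= B * expR (- v) by rewrite mulr_ge0 ?expR_ge0.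
rewrite ler_norml; apply/andP; split.
  have [c _ e] := is_derive_mean (dE (- B)) uv.
  have : 0 <= (df c - - B * expR (- c)) * (v - u).
    by rewrite mulr_ge0//; have := hB c; rewrite ler_norml; lra.
  by rewrite -e; lra.
have [c _ e] := is_derive_mean (dE B) uv.
have : (df c - B * expR (- c)) * (v - u) <= 0.
  by rewrite mulr_le0_ge0//; have := hB c; rewrite ler_norml; lra.
by rewrite -e; lra.
Qed.

(** The limit [l] is $\int_0^\infty e^{-z u^2} du$. The lower bound on its modulus comes from
    [fprim_sqr], where [faux] tends to 0. *)
Lemma fresnel_limit z : 0 < Re z -> exists l : C, exists2 B : R, 0 <= B &
  (forall u, 0 <= u -> normc (fprim z u - l) <= B / (1 + u)) /\
  pi / 4 <= normc z * normc l ^+ 2.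
Proof.
move=> z0; pose B : R := expR (Re z)^-1.
have B0 : 0 <= B by exact: expR_ge0.
have hB u : normc (cgauss z u) <= B * expR (- u).
  rewrite normc_cgauss -expRD ler_expR -subr_ge0.
  have zV : Re z * (Re z)^-1 = 1 by rewrite mulfV// gt_eqF.
  have : 0 < (Re z)^-1 by rewrite invr_gt0.
  move: zV; move: (Re z) (Re z)^-1 z0 => a b a0 ab b0.
  have -> : b - u - - (a * u ^+ 2) = b * ((a * u - 1 / 2) ^+ 2 + 3 / 4) +
    (1 - a * b) * (a * u ^+ 2 - u) by field.
  by rewrite ab subrr mul0r addr0 mulr_ge0 ?(ltW b0)// addr_ge0 ?sqr_ge0//.
have dRe u := (is_derivC_fprim u z0).1; have dIm u := (is_derivC_fprim u z0).2.
have [l1 hl1] := exists_limit_rate (fun u v => is_derive_exp_rate dRe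
  (fun w => le_trans (ler_Re_normc _) (hB w))).
have [l2 hl2] := exists_limit_rate (fun u v => is_derive_exp_rate dIm
  (fun w => le_trans (ler_Im_normc _) (hB w))).
have hl u : 0 <= u -> normc (fprim z u - (l1 +i* l2)) <= (B + B) / (1 + u).
  move=> u0; apply: (le_trans (normc_leD _)).
  rewrite complexRe_D complexIm_D complexRe_N complexIm_N mulrDl.
  by apply: lerD; [exact: hl1|exact: hl2].
exists (l1 +i* l2), (B + B) => //; first exact: addr_ge0.
split => //; set l := l1 +i* l2.
rewrite -subr_le0; pose D := B + B; have D0 : 0 <= D by exact: addr_ge0.
pose K := normc z * (2 * normc l * D + D ^+ 2) + 2 * B.
(* Everything is evaluated at $u = n$, where the rate $1/(1+u)$ is [e]. The constant [K] collects
   the errors of the square of [fprim] and of [faux]. *)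
apply: (le0_div_nat (K := K)) => n.
have n0 : 0 < n.+1%:R :> R by [].
have n1 : 1 + n%:R = n.+1%:R :> R by rewrite nat1r.
have hn : 0 <= n%:R :> R by [].
set e := n.+1%:R^-1; have e0 : 0 <= e by rewrite invr_ge0 ltW.
have e1 : e <= 1 by rewrite invf_le1// ler1n.
have hPhi : normc (fprim z n%:R) <= normc l + D * e.
  have := hl _ hn; rewrite n1 -/D -/e => h.
  have := le_normcD (fprim z n%:R - l) l; rewrite subrK => h'.
  by apply: (le_trans h'); rewrite addrC lerD2l.
have hE : normc (faux z n%:R) <= 2 * (B * e).
  apply: (le_trans (normc_faux _ z0)); rewrite ler_wpM2l//.
  apply: (le_trans (hB _)); rewrite ler_wpM2l//.
  rewrite expRN /e lef_pV2 ?posrE ?expR_gt0//.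
  by rewrite -n1 expR_ge1Dx.
have main : pi / 4 <= normc z * normc (fprim z n%:R) ^+ 2 + normc (faux z n%:R).
  have h : (pi / 4)%:C = z * (fprim z n%:R * fprim z n%:R) + faux z n%:R.
    by rewrite -expr2 fprim_sqr// subrK.
  have -> : pi / 4 = normc (pi / 4)%:C :> R.
    by rewrite normc_real ger0_norm// divr_ge0// pi_ge0.
  by rewrite h (le_trans (le_normcD _ _))// Normc.normcM Normc.normcM -expr2.
have sq : normc (fprim z n%:R) ^+ 2 <= (normc l + D * e) ^+ 2.
  by rewrite lerXn2r ?nnegrE ?normc_ge0// addr_ge0 ?normc_ge0// mulr_ge0.
have sq2 : (normc l + D * e) ^+ 2 <= normc l ^+ 2 + (2 * normc l * D + D ^+ 2) * e.
  have -> : (normc l + D * e) ^+ 2 =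
    normc l ^+ 2 + (2 * normc l * D + D ^+ 2 * e) * e by ring.
  by rewrite lerD2l ler_wpM2r// lerD2l ler_piMr ?sqr_ge0.
have := ler_wpM2l (normc_ge0 z) (le_trans sq sq2).
rewrite /K; lra.
Qed.

End fresnel.

(** * Schwartz functions of several variables given with all their partial derivatives; tensor
    products *)

Section schwartz_jets.
Set Implicit Arguments.
Unset Strict Implicit.
Variable R : realType.
Variable n : nat.
Local Notation C := R[i].
Local Notation E := 'rV[R]_n.
Local Open Scope complex_scope.
Local Notation normc := (@Normc.normc R).
Local Notation Re := (@complex.Re R).
Local Notation Im := (@complex.Im R).
Implicit Types (a : C) (x v : E) (f g : E -> C).

(** Full differentiability accompanies the directional derivative because [schwartz] demands it at
    every order. *)
Definition is_dirC x v f (d : C) : Prop :=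
  [/\ differentiable (fun y => Re (f y)) x, differentiable (fun y => Im (f y)) x,
      is_derive x v (fun y => Re (f y)) (Re d) &
      is_derive x v (fun y => Im (f y)) (Im d)].

Lemma is_dirC_eq x v f d d' : is_dirC x v f d -> d = d' -> is_dirC x v f d'.
Proof. by move=> + <-. Qed.

Lemma is_dirC_cst x v a : is_dirC x v (fun=> a) 0.
Proof. by split; [exact: differentiable_cst..|exact: is_derive_cst|exact: is_derive_cst]. Qed.

Lemma is_dirCD x v f g df dg : is_dirC x v f df -> is_dirC x v g dg ->
  is_dirC x v (fun y => f y + g y) (df + dg).
Proof.
move=> [f1 f2 f3 f4] [g1 g2 g3 g4]; split.
- by under eq_fun do rewrite complexRe_D; exact: differentiableD.
- by under eq_fun do rewrite complexIm_D; exact: differentiableD.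
- by under eq_fun do rewrite complexRe_D; rewrite complexRe_D; exact: is_deriveD.
- by under eq_fun do rewrite complexIm_D; rewrite complexIm_D; exact: is_deriveD.
Qed.

Lemma is_dirCM x v f g df dg : is_dirC x v f df -> is_dirC x v g dg ->
  is_dirC x v (fun y => f y * g y) (df * g x + f x * dg).
Proof.
move=> [f1 f2 f3 f4] [g1 g2 g3 g4]; split.
- by under eq_fun do rewrite complexRe_M; apply: differentiableB; exact: differentiableM.
- by under eq_fun do rewrite complexIm_M; apply: differentiableD; exact: differentiableM.
- under eq_fun do rewrite complexRe_M.
  apply: is_derive_eq (is_deriveB (is_deriveM f3 g3) (is_deriveM f4 g4)) _.
  rewrite complexRe_D !complexRe_M /GRing.scale /=; ring.
- under eq_fun do rewrite complexIm_M.
  apply: is_derive_eq (is_deriveD (is_deriveM f3 g4) (is_deriveM f4 g3)) _.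
  rewrite complexIm_D !complexIm_M /GRing.scale /=; ring.
Qed.

Lemma diff_coord x v (j : 'I_n) : 'd (fun y : E => y 0 j : R) x v = v 0 j.
Proof.
have lin : linear (fun y : E => y 0 j : R) by move=> r y z; rewrite !mxE.
pose linM := GRing.isLinear.Build _ _ _ _ _ lin.
pose f : {linear E -> R} := HB.pack (fun y : E => y 0 j : R) linM.
by rewrite (_ : (fun _ => _) = f)// diff_lin//; exact: coord_continuous.
Qed.

Lemma is_dirC_coord x v (j : 'I_n) (f : R -> C) d : is_derivC (x 0 j) f d ->
  is_dirC x v (fun y => f (y 0 j)) ((v 0 j)%:C * d).
Proof.
move=> [f1 f2].
have dj := @differentiable_coord R 1 n x 0 j.
have gen (g : R -> R) dg : is_derive (x 0 j) 1 g dg ->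
    differentiable (fun y : E => g (y 0 j)) x /\
    is_derive x v (fun y : E => g (y 0 j)) (v 0 j * dg).
  move=> hg; have dg1 : differentiable g (x 0 j).
    by apply/derivable1_diffP; exact: ex_derive.
  have dgc : differentiable (g \o (fun y : E => y 0 j : R)) x.
    exact: differentiable_comp.
  split => //; apply: DeriveDef; first exact: diff_derivable.
  rewrite [LHS](_ : _ = 'D_v (g \o (fun y : E => y 0 j : R)) x)// deriveE//.
  rewrite diff_comp//= diff_coord -[in LHS](mulr1 (v 0 j)).
  rewrite -[v 0 j * 1]/(v 0 j *: (1 : R)) linearZ -deriveE//.
  by congr (_ * _); apply: derive_val.
have [r1 r2] := gen _ _ f1; have [i1 i2] := gen _ _ f2.
split => //; first by rewrite complexRe_M /= mul0r subr0.
by rewrite complexIm_M /= mul0r addr0.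
Qed.

Lemma is_dirC_prod0 x v (I : Type) (r : seq I) (P : pred I) (F : I -> E -> C) :
  (forall i, P i -> is_dirC x v (F i) 0) ->
  is_dirC x v (fun y => \prod_(i <- r | P i) F i y) 0.
Proof.
move=> hF; elim: r => [|i r ih].
  by under eq_fun do rewrite big_nil; exact: is_dirC_cst.
case Pi : (P i); under eq_fun do rewrite big_cons Pi; last exact: ih.
by apply: is_dirC_eq (is_dirCM (hF i Pi) ih) _; rewrite mul0r mulr0 addr0.
Qed.

(** The last derivative taken stands at the head of the list, as in the [foldr] of [partial]. *)
Definition is_mjet (D : seq 'I_n -> E -> C) :=
  forall s j x, is_dirC x (delta_mx 0 j) (D s) (D (j :: s) x).

Definition mdecays (D : seq 'I_n -> E -> C) :=
  forall s m, exists M : R, forall x, `|x| ^+ m * normc (D s x) <= M.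

Lemma partial_mjet D s : is_mjet D ->
  Defs.partial s (fun y => Re (D [::] y)) = (fun y => Re (D s y)) /\
  Defs.partial s (fun y => Im (D [::] y)) = (fun y => Im (D s y)).
Proof.
move=> hD; elim: s => [|j s [ih1 ih2]]; first by [].
split; apply/funext => x; have [_ _ h1 h2] := hD s j x.
  by rewrite /= ih1; apply: derive_val.
by rewrite /= ih2; apply: derive_val.
Qed.

Lemma partialC_mjet D s x : is_mjet D -> partialC s (D [::]) x = D s x.
Proof.
move=> /(partial_mjet s) [h1 h2].
by apply: eq_complexP; rewrite /partialC /= ?h1 ?h2.
Qed.

(** Differentiability is read off from the derivative in the direction [j0]; in dimension 0
    [is_mjet] would be vacuous. *)
Lemma schwartz_mjet (j0 : 'I_n) D : is_mjet D -> mdecays D -> schwartz (D [::]).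
Proof.
move=> hD dD s; have [h1 h2] := partial_mjet s hD; rewrite h1 h2.
split; first by move=> x; have [] := hD s j0 x.
split; first by move=> x; have [] := hD s j0 x.
by move=> k; have [M hM] := dD s k; exists M => x; rewrite partialC_mjet.
Qed.

Lemma schwartz_seminorm_le D k (B : R) : is_mjet D ->
  (forall s m x, (size s <= k)%N -> (m <= k)%N ->
     `|x| ^+ m * normc (D s x) <= B) ->
  (schwartz_seminorm k (D [::]) <= B%:E)%E.
Proof.
move=> hD hB; apply: ge_ereal_sup => _ [s [m [x [sk mk ->]]]].
by rewrite lee_fin partialC_mjet//; exact: hB.
Qed.

Lemma is_mjet_lin a D D' : is_mjet D -> is_mjet D' ->
  is_mjet (fun s x => a * D s x + D' s x).
Proof.
move=> h h' s j x; apply: is_dirCD (h' s j x).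
by apply: is_dirC_eq (is_dirCM (is_dirC_cst _ _ a) (h s j x)) _; rewrite mul0r add0r.
Qed.

Lemma mdecays_lin a D D' : mdecays D -> mdecays D' ->
  mdecays (fun s x => a * D s x + D' s x).
Proof.
move=> h h' s m; have [M hM] := h s m; have [M' hM'] := h' s m.
exists (normc a * M + M') => x.
apply: (@le_trans _ _ (normc a * (`|x| ^+ m * normc (D s x)) + `|x| ^+ m * normc (D' s x))).
  rewrite mulrCA -mulrDr ler_wpM2l ?exprn_ge0//.
  by apply: (le_trans (le_normcD _ _)); rewrite Normc.normcM.
by apply: lerD => //; rewrite ler_wpM2l ?normc_ge0.
Qed.

(** A product of one-variable jets: a partial derivative depends on [s] only through the
    multiplicity of each direction, and [[::]] gives the function itself. *)
Definition tensor (F : 'I_n -> nat -> R -> C) (s : seq 'I_n) x : C :=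
  \prod_(j < n) F j (count_mem j s) (x 0 j).

Lemma is_mjet_tensor F : (forall j, is_jet (F j)) -> is_mjet (tensor F).
Proof.
move=> hF s j x; rewrite /tensor.
under eq_fun do rewrite (bigD1 j)//=.
rewrite (bigD1 j)//= eqxx add1n.
apply: is_dirC_eq.
  apply: is_dirCM.
    exact: is_dirC_coord (hF j _ _).
  apply: is_dirC_prod0 => i ij.
  apply: is_dirC_eq; first exact: is_dirC_coord (hF i _ _).
  by rewrite mxE eqxx /= (negbTE ij) mul0r.
rewrite mulr0 addr0 mxE !eqxx mul1r; congr (_ * _).
by apply: eq_bigr => i ij; rewrite eq_sym (negbTE ij) add0n.
Qed.

(** The sup norm is attained at one coordinate, and the factors of the other coordinates are at
    least 1. This lets the weight be distributed over a tensor product. *)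
Lemma norm_le_coords x m k : (m <= k)%N ->
  `|x| ^+ m <= \prod_(j < n) (1 + `|x 0 j|) ^+ k.
Proof.
move=> mk.
have h1 (j : 'I_n) : 1 <= (1 + `|x 0 j|) ^+ k by rewrite exprn_ege1// lerDl.
have h2 (P : pred 'I_n) : 1 <= \prod_(j < n | P j) (1 + `|x 0 j|) ^+ k.
  by elim/big_ind: _ => // y z y1 z1; rewrite mulr_ege1.
have [->|x0] := eqVneq `|x| 0.
  by apply: le_trans (h2 predT); rewrite expr0n; case: (m == 0)%N.
have [[i j] /= xj] : exists i, `|x| = `|x i.1 i.2|.
  exact: mx_norm_neq0 x0.
rewrite (ord1 i) in xj; rewrite xj (bigD1 j)//=.
apply: (@le_trans _ _ ((1 + `|x 0 j|) ^+ k)).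
  apply: (@le_trans _ _ ((1 + `|x 0 j|) ^+ m)); last by rewrite ler_weXn2l// lerDl.
  by rewrite lerXn2r ?nnegrE ?addr_ge0// lerDr.
by rewrite ler_peMr// (le_trans ler01).
Qed.

Lemma tensor_bound F k (B : R) : (forall j, jet_bound k B (F j)) ->
  forall s m x, (size s <= k)%N -> (m <= k)%N ->
    `|x| ^+ m * normc (tensor F s x) <= B ^+ n.
Proof.
move=> hB s m x sk mk.
apply: (@le_trans _ _ ((\prod_(j < n) (1 + `|x 0 j|) ^+ k) * normc (tensor F s x))).
  by rewrite ler_wpM2r ?normc_ge0// norm_le_coords.
rewrite normc_prod -big_split /= -[X in B ^+ X]card_ord -prodr_const.
apply: ler_prod => j _; rewrite mulr_ge0 ?normc_ge0 ?exprn_ge0 ?addr_ge0//=.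
by apply: hB; exact: leq_trans (count_size _ _) sk.
Qed.

End schwartz_jets.

(** * Continuity of a tempered distribution on tensor products *)

Section tempered_tensor.
Set Implicit Arguments.
Unset Strict Implicit.
Variable R : realType.
Local Notation C := R[i].
Local Open Scope complex_scope.
Local Notation normc := (@Normc.normc R).

(** The sum of the finitely many bounds serves for all coordinates. *)
Lemma finite_uniform (n : nat) (P : 'I_n -> R -> Prop) :
  (forall j, exists2 B, 0 <= B & P j B) ->
  (forall j B B', B <= B' -> P j B -> P j B') ->
  exists2 B, 0 <= B & forall j, P j B.
Proof.
move=> h mono.
have /choice [b hb] : forall j, exists B, 0 <= B /\ P j B.
  by move=> j; have [B B0 PB] := h j; exists B.
exists (\sum_j b j) => [|j]; first by apply: sumr_ge0 => j _; have [] := hb j.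
have [_] := hb j; apply: mono; rewrite (bigD1 j)//= lerDl.
by apply: sumr_ge0 => i _; have [] := hb i.
Qed.

Lemma jet_boundW k (B B' : R) (F : nat -> R -> C) :
  B <= B' -> jet_bound k B F -> jet_bound k B' F.
Proof. by move=> BB hB i t ik; exact: le_trans (hB i t ik) BB. Qed.

Lemma decays_jet_bound k (F : nat -> R -> C) : decays F ->
  exists2 B, 0 <= B & jet_bound k B F.
Proof.
by move=> /decays_bounded /(_ k)[B B0 hB]; exists B => // i t ik; exact: hB.
Qed.

Lemma jet_bound_decays (F : nat -> R -> C) :
  (forall k, exists B, jet_bound k B F) -> decays F.
Proof.
move=> h k m; have [B hB] := h (maxn k m); exists B => u.
apply: le_trans (hB k u (leq_maxl k m)); rewrite ler_wpM2r ?normc_ge0//.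
by rewrite ler_weXn2l ?leq_maxr// lerDl.
Qed.

Variable n : nat.
Local Notation E := 'rV[R]_n.
Variable j0 : 'I_n.

Lemma mdecays_tensor (F : 'I_n -> nat -> R -> C) :
  (forall j, decays (F j)) -> mdecays (tensor F).
Proof.
move=> dF s m; pose k := maxn (size s) m.
have [B B0 hB] := finite_uniform (P := fun j B => jet_bound k B (F j))
  (fun j => decays_jet_bound k (dF j)) (fun j B B' => @jet_boundW k B B' (F j)).
by exists (B ^+ n) => x; apply: (tensor_bound hB); rewrite ?leq_maxl ?leq_maxr.
Qed.

(** The factors are replaced one at a time; each replacement costs [e] times a product of factors
    bounded by [B]. *)
Lemma normc_prodB (r : seq 'I_n) (a b : 'I_n -> C) (B e : R) : 1 <= B ->
  (forall j, normc (a j) <= B) -> (forall j, normc (b j) <= B) ->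
  (forall j, normc (a j - b j) <= e) ->
  normc (\prod_(j <- r) a j - \prod_(j <- r) b j) <=
    (size r)%:R * B ^+ size r * e.
Proof.
move=> B1 ha hb he.
have B0 : 0 <= B by exact: le_trans B1.
have e0 : 0 <= e by exact: le_trans (normc_ge0 _) (he j0).
elim: r => [|j r ih]; first by rewrite !big_nil subrr Normc.normc0 !mul0r.
rewrite !big_cons.
have -> : a j * \prod_(i <- r) a i - b j * \prod_(i <- r) b i =
    (a j - b j) * \prod_(i <- r) a i +
    b j * (\prod_(i <- r) a i - \prod_(i <- r) b i) by ring.
apply: (le_trans (le_normcD _ _)); rewrite !Normc.normcM.
have hA : normc (\prod_(i <- r) a i) <= B ^+ size r.
  elim: r {ih} => [|i r ihr]; first by rewrite big_nil Normc.normc1 expr0.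
  by rewrite big_cons Normc.normcM exprS ler_pM ?normc_ge0.
apply: (@le_trans _ _ (e * B ^+ size r + B * ((size r)%:R * B ^+ size r * e))).
  by apply: lerD; apply: ler_pM => //; exact: normc_ge0.
rewrite /= -natr1 exprS.
have h : B ^+ size r * e <= B * B ^+ size r * e.
  by rewrite ler_wpM2r// ler_peMl// exprn_ge0.
have -> : ((size r)%:R + 1) * (B * B ^+ size r) * e =
  B * ((size r)%:R * B ^+ size r * e) + B * B ^+ size r * e by ring.
by rewrite addrC lerD2l mulrC.
Qed.

Lemma tensor_diff_bound (F G : 'I_n -> nat -> R -> C) k (B e : R) : 1 <= B ->
  (forall j, jet_bound k B (F j)) -> (forall j, jet_bound k B (G j)) ->
  (forall j, jet_bound k e (fun i t => F j i t - G j i t)) ->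
  forall s m x, (size s <= k)%N -> (m <= k)%N ->
    `|x| ^+ m * normc (tensor F s x - tensor G s x) <= n%:R * B ^+ n * e.
Proof.
move=> B1 hF hG hFG s m x sk mk.
have ck j : (count_mem j s <= k)%N by exact: leq_trans (count_size _ _) sk.
pose w (j : 'I_n) : R := (1 + `|x 0 j|) ^+ k.
have w0 j : 0 <= w j by rewrite exprn_ge0// addr_ge0.
have nw j : normc (w j)%:C = w j by rewrite normc_real ger0_norm.
apply: (@le_trans _ _ (normc (\prod_j ((w j)%:C * F j (count_mem j s) (x 0 j))
    - \prod_j ((w j)%:C * G j (count_mem j s) (x 0 j))))).
  rewrite !big_split /= -mulrBr Normc.normcM ler_wpM2r ?normc_ge0//.
  rewrite normc_prod; under eq_bigr do rewrite nw.
  exact: norm_le_coords.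
have := @normc_prodB (enum 'I_n)
  (fun j => (w j)%:C * F j (count_mem j s) (x 0 j))
  (fun j => (w j)%:C * G j (count_mem j s) (x 0 j)) B e B1.
rewrite !big_enum size_enum_ord; apply => j.
- by rewrite Normc.normcM nw; exact: hF.
- by rewrite Normc.normcM nw; exact: hG.
- by rewrite -mulrBr Normc.normcM nw; exact: hFG.
Qed.

Variable T : (E -> C) -> C.
Hypothesis temperedT : tempered T.

Definition good_mjet (D : seq 'I_n -> E -> C) := is_mjet D /\ mdecays D.

Lemma good_tensor (F : 'I_n -> nat -> R -> C) :
  (forall j, is_jet (F j)) -> (forall j, decays (F j)) -> good_mjet (tensor F).
Proof. by move=> jF dF; split; [exact: is_mjet_tensor|exact: mdecays_tensor]. Qed.

Lemma good_lin a D D' : good_mjet D -> good_mjet D' ->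
  good_mjet (fun s x => a * D s x + D' s x).
Proof. by move=> [? ?] [? ?]; split; [exact: is_mjet_lin|exact: mdecays_lin]. Qed.

Lemma good_schwartz D : good_mjet D -> schwartz (D [::]).
Proof. by move=> [? ?]; exact: schwartz_mjet. Qed.

Lemma good0 : good_mjet (fun _ _ => 0).
Proof.
split; first by move=> s j x; exact: is_dirC_cst.
by move=> s m; exists 0 => x; rewrite Normc.normc0 mulr0.
Qed.

Lemma tempered_lin a D D' : good_mjet D -> good_mjet D' ->
  T (fun x => a * D [::] x + D' [::] x) = a * T (D [::]) + T (D' [::]).
Proof.
move=> gD gD'; have [lT _] := temperedT.
by apply: (lT a (D [::]) (D' [::])); exact: good_schwartz.
Qed.

Lemma tempered0 : T (fun=> 0) = 0.
Proof.
have := @tempered_lin (-1) _ _ good0 good0.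
by under eq_fun do rewrite mulr0 addr0; rewrite mulN1r addNr.
Qed.

Lemma temperedZ a D : good_mjet D -> T (fun x => a * D [::] x) = a * T (D [::]).
Proof.
move=> gD; have := tempered_lin a gD good0.
by under eq_fun do rewrite addr0; rewrite tempered0 addr0.
Qed.

Lemma temperedB D D' : good_mjet D -> good_mjet D' ->
  T (fun x => D [::] x - D' [::] x) = T (D [::]) - T (D' [::]).
Proof.
move=> gD gD'; have := tempered_lin (-1) gD' gD.
by under eq_fun do rewrite mulN1r addrC; rewrite mulN1r addrC.
Qed.

Lemma tempered_sum (I : Type) (r : seq I) (a : C)
    (D : I -> seq 'I_n -> E -> C) : (forall i, good_mjet (D i)) ->
  T (fun x => \sum_(i <- r) a * D i [::] x) = \sum_(i <- r) a * T (D i [::]).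
Proof.
(* Linearity at each step needs the remaining sum to be a good jet, so both facts go through the
   same induction. *)
move=> gD; suff [_ ->] : good_mjet (fun s x => \sum_(i <- r) a * D i s x) /\
    T (fun x => \sum_(i <- r) a * D i [::] x) = \sum_(i <- r) a * T (D i [::]) by [].
elim: r => [|i r [ih1 ih2]]; split.
- rewrite (_ : (fun _ _ => _) = (fun _ _ => 0)); first exact: good0.
  by apply/funext => s; apply/funext => x; rewrite big_nil.
- by under eq_fun do rewrite big_nil; rewrite big_nil tempered0.
- rewrite (_ : (fun _ _ => _) =
      fun s x => a * D i s x + \sum_(i <- r) a * D i s x); first exact: good_lin.
  by apply/funext => s; apply/funext => x; rewrite big_cons.
- under eq_fun do rewrite big_cons.
  by rewrite big_cons -ih2 (tempered_lin a (gD i) ih1).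
Qed.

Lemma tempered_bound : exists k, exists2 M : R, 0 <= M &
  forall D (B : R), good_mjet D -> (forall s m x, (size s <= k)%N -> (m <= k)%N ->
     `|x| ^+ m * normc (D s x) <= B) -> normc (T (D [::])) <= M * B.
Proof.
(* The constant in [tempered] may be negative; its absolute value still bounds because the seminorm
   is nonnegative. *)
have [_ [k [M hM]]] := temperedT; exists k, `|M| => // D B gD hB.
have B0 : 0 <= B.
  by apply: le_trans (normc_ge0 (D [::] 0)) _; have := hB [::] 0%N 0 isT isT; rewrite mul1r.
rewrite -lee_fin EFinM; apply: (le_trans (hM _ (good_schwartz gD))).
have s0 : (0 <= schwartz_seminorm k (D [::]))%E.
  apply: (@le_trans _ _ (`|0 : E| ^+ 0 * normc (partialC [::] (D [::]) 0))%:E).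
    by rewrite lee_fin expr0 mul1r normc_ge0.
  by apply: ereal_sup_ubound; exists [::], 0%N, 0.
apply: (@le_trans _ _ (`|M|%:E * schwartz_seminorm k (D [::]))%E).
  by apply: lee_wpmul2r => //; rewrite lee_fin ler_norm.
apply: lee_wpmul2l; first by rewrite lee_fin.
by apply: schwartz_seminorm_le hB; case: gD.
Qed.

(** Serves twice: for the convergence of the Riemann sums and for the Lipschitz dependence of the
    pairing on the frequency. Both thereby reduce to estimates in one variable. *)
Lemma tempered_tensor_lip : exists k, exists2 M : R, 0 <= M &
  forall (F G : 'I_n -> nat -> R -> C) (B e : R), 1 <= B ->
  (forall j, is_jet (F j)) -> (forall j, decays (F j)) ->
  (forall j, is_jet (G j)) -> (forall j, decays (G j)) ->
  (forall j, jet_bound k B (F j)) -> (forall j, jet_bound k B (G j)) ->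
  (forall j, jet_bound k e (fun i t => F j i t - G j i t)) ->
  normc (T (tensor F [::]) - T (tensor G [::])) <= M * B ^+ n * e.
Proof.
have [k [M M0 hM]] := tempered_bound; exists k, (M * n%:R) => [|F G B e B1 jF dF jG dG bF bG bFG].
  by rewrite mulr_ge0.
have gF := good_tensor jF dF; have gG := good_tensor jG dG.
rewrite -temperedB//.
have := hM (fun s x => -1 * tensor G s x + tensor F s x) (n%:R * B ^+ n * e)
  (good_lin (-1) gG gF).
under eq_fun do rewrite mulN1r addrC.
rewrite !mulrA; apply => s m x sk mk.
by rewrite mulN1r addrC; exact: tensor_diff_bound.
Qed.

End tempered_tensor.

(** * One variable: the family indexed by the frequency and its Riemann sums *)

Section gaussian_family.
Set Implicit Arguments.
Unset Strict Implicit.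
Variable R : realType.
Local Notation C := R[i].
Local Open Scope complex_scope.
Local Notation normc := (@Normc.normc R).
Local Notation Re := (@complex.Re R).

(** Linear growth of the second factor is paid for by one extra power of the weight on the first. *)
Lemma jet_bound_mul_growth k (A B : R) (F G : nat -> R -> C) : jet_bound k.+1 A F ->
  (forall i t, (i <= k)%N -> normc (G i t) <= (1 + `|t|) * B) ->
  jet_bound k (2 ^+ k * (A * B)) (jet_mul F G).
Proof.
move=> hF hG i t ik.
have w1 : 0 < 1 + `|t| by rewrite ltr_pwDl.
have w0 : 0 < (1 + `|t|) ^+ k by rewrite exprn_gt0.
have A0 : 0 <= A.
  by apply: le_trans (hF 0%N t _) => //; rewrite mulr_ge0 ?normc_ge0// exprn_ge0// ltW.
have B0 : 0 <= B.
  have := le_trans (normc_ge0 _) (hG 0%N t isT).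
  by rewrite pmulr_rge0.
have hm : normc (jet_mul F G i t) <=
    2 ^+ i * (A / (1 + `|t|) ^+ k.+1 * ((1 + `|t|) * B)).
  apply: normc_jet_mul => j ji; last by apply: hG; exact: leq_trans ik.
  rewrite ler_pdivlMr ?exprn_gt0// mulrC; apply: hF.
  by rewrite (leq_trans ji)// (leq_trans ik).
rewrite -ler_pdivlMl//; apply: (le_trans hm).
have -> : A / (1 + `|t|) ^+ k.+1 * ((1 + `|t|) * B) =
    ((1 + `|t|) ^+ k)^-1 * (A * B).
  rewrite exprSr invfM; move: (((1 + `|t|) ^+ k)^-1) => q; field.
  by rewrite gt_eqF.
rewrite mulrCA ler_wpM2l ?invr_ge0 ?(ltW w0)//.
by rewrite ler_wpM2r ?mulr_ge0// ler_weXn2l// ler1n.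
Qed.

Variables (z w : C).
Hypotheses (z0 : 0 < Re z) (w0 : 0 < Re w).

(** The function $e^{-w t^2} e^{-z (\xi + t)^2}$ of $t$. Later [w] is the parameter of the chirp and
    [z] that of the translated Gaussian. *)
Definition gfam (xi : R) := jet_mul (gjet w) (jet_shift xi (gjet z)).

Lemma is_jet_gfam xi : is_jet (gfam xi).
Proof. by apply: is_jet_mul; [|apply: is_jet_shift]; exact: gjet_is_jet. Qed.

Lemma gjet_bounded k : exists2 B : R, 0 <= B &
  forall i u, (i <= k)%N -> normc (gjet z i u) <= B.
Proof.
have [B B0 hB] := decays_bounded (decays_gjet z0) k; exists B => // i u ik.
by have := hB i 0%N u ik isT; rewrite expr0 mul1r.
Qed.

Lemma gfam_bound k : exists2 B : R, 0 <= B & forall xi, jet_bound k B (gfam xi).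
Proof.
have [A A0 hA] := decays_jet_bound k (decays_gjet w0).
have [B B0 hB] := gjet_bounded k.
exists (2 ^+ k * (A * B)) => [|xi]; first by rewrite !mulr_ge0// exprn_ge0.
by apply: jet_bound_mul => // i t ik; exact: hB.
Qed.

Lemma decays_gfam xi : decays (gfam xi).
Proof.
apply: jet_bound_decays => k; have [B _ hB] := gfam_bound k.
by exists B; exact: hB.
Qed.

(** Only the second factor moves, and its translates differ by the mean value bound, at the price of
    one more derivative. *)
Lemma gfam_lipschitz k : exists2 L : R, 0 <= L & forall xi xi',
  jet_bound k (L * `|xi - xi'|) (fun i t => gfam xi i t - gfam xi' i t).
Proof.
have [A A0 hA] := decays_jet_bound k (decays_gjet w0).
have [B B0 hB] := gjet_bounded k.+1.
exists (2 ^+ k * (A * (2 * B))) => [|xi xi' i t ik].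
  by rewrite !mulr_ge0// exprn_ge0.
rewrite -!mulrA -jet_mulB (mulrA 2); move: i t ik.
apply: jet_bound_mul => // i t ik.
have -> : xi - xi' = (xi + t) - (xi' + t) by rewrite opprD addrACA subrr addr0.
rewrite /jet_shift; apply: (is_derivC_lipschitz (f := gjet z i) (df := gjet z i.+1)) => u.
  exact: gjet_is_jet.
by apply: hB; rewrite ltnS.
Qed.

Definition cst_jet (a : C) (i : nat) (t : R) : C := if i is 0 then a else 0.

Lemma is_jet_cst a : is_jet (cst_jet a).
Proof. by case=> [|k] t; exact: is_derivC_cst. Qed.

Lemma decays_mul_cst a : decays (jet_mul (gjet w) (cst_jet a)).
Proof.
apply: jet_bound_decays => k.
have [A A0 hA] := decays_jet_bound k (decays_gjet w0).
exists (2 ^+ k * (A * normc a)); apply: jet_bound_mul => // -[|i] t _ //.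
by rewrite /cst_jet Normc.normc0 normc_ge0.
Qed.

(** Left endpoints of the [K] equal subintervals of $[-Y, Y]$. *)
Definition grid (Y : R) (K c : nat) : R := - Y + 2 * Y / K%:R * c%:R.

(** Left Riemann sum, over $\xi$ in $[-Y, Y]$, of the [i]-th derivative of $e^{-z (\xi + t)^2}$. *)
Definition theta (Y : R) (K i : nat) (t : R) : C :=
  \sum_(c < K) (2 * Y / K%:R)%:C * gjet z i (grid Y K c + t).

Lemma is_jet_theta Y K : is_jet (theta Y K).
Proof.
move=> i t; apply: is_derivC_sum => c; apply: is_derivCZ.
exact: is_derivC_shift (gjet_is_jet z i _).
Qed.

Lemma decays_mul_theta Y K : decays (jet_mul (gjet w) (theta Y K)).
Proof.
apply: jet_bound_decays => k.
have [A A0 hA] := decays_jet_bound k (decays_gjet w0).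
have [B B0 hB] := gjet_bounded k.
exists (2 ^+ k * (A * \sum_(c < K) normc (2 * Y / K%:R)%:C * B)).
apply: jet_bound_mul => // i t ik; apply: (le_trans (normc_sum _ _ _)).
apply: ler_sum => c _; rewrite Normc.normcM ler_wpM2l ?normc_ge0//.
exact: hB.
Qed.

(** The derivatives of [fprim], hence an antiderivative of each [gjet z i]. *)
Let gprim i : R -> C := if i is i'.+1 then gjet z i' else fprim z.

Let is_derivC_gprim i u : is_derivC u (gprim i) (gjet z i u).
Proof. by case: i => [|i]; [exact: is_derivC_fprim|exact: gjet_is_jet]. Qed.

(** Each cell of width $d$ contributes at most $4 B d^2$ by Taylor's formula, and the [K] cells have
    total length $2Y$, whence $8 B Y d$. *)
Let theta_gprim k : exists2 B : R, 0 <= B & forall i Y K t, (i <= k)%N -> 0 <= Y ->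
  (0 < K)%N -> normc (theta Y K i t - (gprim i (Y + t) - gprim i (- Y + t))) <=
    B * (Y * (2 * Y / K%:R)).
Proof.
have [B B0 hB] := gjet_bounded k.+1; exists (8 * B) => [|i Y K t ik Y0 K0].
  by rewrite mulr_ge0.
set d := 2 * Y / K%:R.
have Kd : K%:R * d = 2 * Y by rewrite mulrC divfK// pnatr_eq0 -lt0n.
have d0 : 0 <= d by rewrite divr_ge0// mulr_ge0.
have -> : gprim i (Y + t) - gprim i (- Y + t) =
    \sum_(c < K) (gprim i (grid Y K c + t + d) - gprim i (grid Y K c + t)).
  rewrite -(big_mkord xpredT (fun c => gprim i (grid Y K c + t + d) -
     gprim i (grid Y K c + t))).
  have e (c : nat) : grid Y K c + t + d = grid Y K c.+1 + t.
    by rewrite /grid -/d -natr1; ring.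
  under eq_bigr do rewrite e.
  rewrite (telescope_sumr (fun c => gprim i (grid Y K c + t)))//.
  by rewrite /grid -/d mulr0 addr0 (mulrC d) Kd; congr (gprim i _ - _); ring.
rewrite /theta -sumrB; apply: (le_trans (normc_sum _ _ _)).
apply: (@le_trans _ _ (\sum_(c < K) 4 * B * d ^+ 2)).
  apply: ler_sum => c _; rewrite -normcN opprB.
  apply: (is_derivC_taylor1 (df := gjet z i) (d2f := gjet z i.+1)) => // u.
    exact: gjet_is_jet.
  by apply: hB; rewrite ltnS.
rewrite sumr_const card_ord.
have -> : 4 * B * d ^+ 2 *+ K = 4 * B * d * (K%:R * d).
  by rewrite -[LHS]mulr_natr; ring.
by rewrite Kd le_eqVlt; apply/orP; left; apply/eqP; ring.
Qed.

Let inv_shift (Y t : R) : 0 <= Y -> (1 + `|Y + t|)^-1 <= (1 + `|t|) / (1 + Y).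
Proof.
move=> Y0; rewrite ler_pdivlMr ?ltr_pwDl// mulrC ler_pdivrMr ?ltr_pwDl//.
have h : Y <= `|Y + t| + `|t|.
  by apply: (le_trans (ler_norm Y)); rewrite -{1}(addrK t Y) ler_normB.
have := normr_ge0 t; have := normr_ge0 (Y + t); nra.
Qed.

(** As $Y$ grows, the integral over $[-Y, Y]$ tends to $2l$, by oddness of [fprim] at the lower end,
    and its derivatives in $t$ tend to 0. The rate is uniform in $t$ up to linear growth. *)
Let gprim_end (l : C) (B0 : R) k : 0 <= B0 ->
  (forall u, 0 <= u -> normc (fprim z u - l) <= B0 / (1 + u)) ->
  exists2 D : R, 0 <= D & forall i Y t, (i <= k)%N -> 0 <= Y ->
    normc (gprim i (Y + t) - gprim i (- Y + t) - cst_jet (2 * l) i t) <=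
      (1 + `|t|) * (D / (1 + Y)).
Proof.
move=> B00 hl.
have hf Y t : 0 <= Y -> normc (fprim z (Y + t) - l) <=
    (2 * normc l + B0) * ((1 + `|t|) / (1 + Y)).
  (* When $Y + t < 0$, $|t|$ exceeds $Y$ and the quotient $(1 + |t|)/(1 + Y)$ is at least 1, so
     boundedness of [fprim] is enough. *)
  move=> Y0; have [Yt|Yt] := leP 0 (Y + t).
    apply: (le_trans (hl _ Yt)); rewrite -{1}(ger0_norm Yt).
    apply: ler_pM => //.
      by rewrite lerDr mulr_ge0 ?normc_ge0.
    exact: inv_shift.
  apply: (@le_trans _ _ (2 * normc l + B0)).
    rewrite -(opprK (Y + t)) fprimN.
    have Nv : 0 <= - (Y + t) by rewrite oppr_ge0 ltW.
    have -> : - fprim z (- (Y + t)) - l = - (fprim z (- (Y + t)) - l) - 2 * l by ring.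
    apply: (le_trans (le_normcD _ _)); rewrite !normcN Normc.normcM addrC.
    have -> : normc 2 = 2 by rewrite -(rmorph_nat (real_complex R)) normc_real normr_nat.
    rewrite lerD2l; apply: (le_trans (hl _ Nv)).
    by rewrite ler_pdivrMr ?ltr_pwDl// ler_peMr// lerDl.
  rewrite ler_peMr ?addr_ge0 ?mulr_ge0 ?normc_ge0//.
  rewrite ler_pdivlMr ?ltr_pwDl// mul1r lerD2l.
  have := ler_norm (- t); rewrite normrN; lra.
have [B1 B10 hB1] := decays_bounded (decays_gjet z0) k.+1.
have hg i Y t : (i <= k)%N -> 0 <= Y ->
    normc (gjet z i (Y + t)) <= B1 * ((1 + `|t|) / (1 + Y)).
  move=> ik Y0; apply: (@le_trans _ _ (B1 / (1 + `|Y + t|))).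
    rewrite ler_pdivlMr ?ltr_pwDl// mulrC.
    by have := hB1 i 1%N (Y + t) (leqW ik) isT; rewrite expr1.
  by rewrite ler_wpM2l// inv_shift.
have hg' i Y t : (i <= k)%N -> 0 <= Y ->
    normc (gjet z i (- Y + t)) <= B1 * ((1 + `|t|) / (1 + Y)).
  move=> ik Y0; apply: (@le_trans _ _ (B1 / (1 + `|- Y + t|))).
    rewrite ler_pdivlMr ?ltr_pwDl// mulrC.
    by have := hB1 i 1%N (- Y + t) (leqW ik) isT; rewrite expr1.
  rewrite ler_wpM2l//; have := inv_shift (- t) Y0; rewrite normrN.
  by have -> : `|Y - t| = `|- Y + t| by rewrite distrC addrC.
pose D := 2 * (2 * normc l + B0) + 2 * B1.
have D10 : 0 <= 2 * (2 * normc l + B0) by rewrite mulr_ge0// addr_ge0// mulr_ge0 ?normc_ge0.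
exists D => [|[|i] Y t ik Y0]; first by rewrite addr_ge0// mulr_ge0.
  have -> : gprim 0 (Y + t) - gprim 0 (- Y + t) - cst_jet (2 * l) 0 t =
      (fprim z (Y + t) - l) + (fprim z (Y + - t) - l).
    rewrite /gprim /cst_jet (_ : - Y + t = - (Y + - t)) ?fprimN; first by ring.
    by rewrite opprD opprK.
  apply: (le_trans (le_normcD _ _)).
  have h1 := hf Y t Y0; have h2 := hf Y (- t) Y0; rewrite normrN in h2.
  apply: (le_trans (lerD h1 h2)).
  have q0 : 0 <= (1 + `|t|) / (1 + Y) by rewrite divr_ge0 ?addr_ge0.
  rewrite [leRHS]mulrCA /D; nra.
rewrite /gprim /cst_jet subr0; apply: (le_trans (le_normcD _ _)); rewrite normcN.
have ik' : (i <= k)%N by exact: ltnW.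
apply: (le_trans (lerD (hg i Y t ik' Y0) (hg' i Y t ik' Y0))).
have q0 : 0 <= (1 + `|t|) / (1 + Y) by rewrite divr_ge0 ?addr_ge0.
rewrite [leRHS]mulrCA /D; nra.
Qed.

(** The two error terms are those of discretization, from [theta_gprim], and of truncation, from
    [gprim_end]; the decay of [gjet w] absorbs the growth in $t$. *)
Lemma theta_bound (l : C) (B0 : R) k : 0 <= B0 ->
  (forall u, 0 <= u -> normc (fprim z u - l) <= B0 / (1 + u)) ->
  exists2 D : R, 0 <= D & forall Y K, 0 <= Y -> (0 < K)%N ->
    jet_bound k (D * (Y * (2 * Y / K%:R) + (1 + Y)^-1)) (fun i t =>
      jet_mul (gjet w) (theta Y K) i t -
      jet_mul (gjet w) (cst_jet (2 * l)) i t).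
Proof.
move=> B00 hl.
have [A A0 hA] := decays_jet_bound k.+1 (decays_gjet w0).
have [D1 D10 hD1] := gprim_end k B00 hl.
have [D2 D20 hD2] := theta_gprim k.
exists (2 ^+ k * (A * (D1 + D2))) => [|Y K Y0 K0].
  by rewrite !mulr_ge0 ?exprn_ge0 ?addr_ge0.
set e := Y * _; rewrite -[2 ^+ k * _ * _]mulrA -[A * _ * _]mulrA.
move=> i t ik; rewrite -jet_mulB; move: i t ik.
have e0 : 0 <= e by rewrite mulr_ge0// divr_ge0// mulr_ge0.
apply: jet_bound_mul_growth => // i t ik.
have -> : theta Y K i t - cst_jet (2 * l) i t =
  (theta Y K i t - (gprim i (Y + t) - gprim i (- Y + t))) +
  (gprim i (Y + t) - gprim i (- Y + t) - cst_jet (2 * l) i t) by ring.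
apply: (le_trans (le_normcD _ _)).
apply: (le_trans (lerD (hD2 _ _ _ _ ik Y0 K0) (hD1 _ _ _ ik Y0))).
rewrite -/e; have q0 : 0 <= (1 + Y)^-1 by rewrite invr_ge0 addr_ge0.
have t0 := normr_ge0 t.
have m1 : 0 <= D1 * e by rewrite mulr_ge0.
have m2 : 0 <= D2 * e by rewrite mulr_ge0.
have m3 : 0 <= D2 * (1 + Y)^-1 by rewrite mulr_ge0.
have -> : (1 + `|t|) * ((D1 + D2) * (e + (1 + Y)^-1)) =
  (1 + `|t|) * (D1 * e) + D2 * e + `|t| * (D2 * e) +
  (1 + `|t|) * (D1 * (1 + Y)^-1) + (1 + `|t|) * (D2 * (1 + Y)^-1) by ring.
have : 0 <= (1 + `|t|) * (D1 * e) by rewrite mulr_ge0// addr_ge0.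
have : 0 <= `|t| * (D2 * e) by rewrite mulr_ge0.
have : 0 <= (1 + `|t|) * (D2 * (1 + Y)^-1) by rewrite mulr_ge0// addr_ge0.
lra.
Qed.

End gaussian_family.

(** * Lower bounds of integrals over $\mathbb{R}^n$ by step functions on cubes *)

Section grid_integral.
Set Implicit Arguments.
Unset Strict Implicit.
Variable R : realType.

(** The integral of a nonnegative function is a supremum over the simple functions below it, which
    is monotone whether or not the functions are measurable. *)
Lemma ge0_le_integral_nonmeas d (T : measurableType d)
    (mu : {measure set T -> \bar R}) (f g : T -> \bar R) :
  (forall x, 0 <= f x)%E -> (forall x, f x <= g x)%E ->
  (\int[mu]_x f x <= \int[mu]_x g x)%E.
Proof.
move=> f0 fg; have g0 x : (0 <= g x)%E by exact: le_trans (f0 x) (fg x).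
rewrite !ge0_integralTE//; apply: le_ereal_sup => _ [h hf <-].
by exists h => // x; exact: le_trans (hf x) (fg x).
Qed.

(** Half-open, so that the cells of a grid are disjoint. *)
Definition box n (a : 'I_n -> R) (d : R) :
    set (n.-tuple (measurableTypeR R)) :=
  [set t | forall j, a j <= tnth t j < a j + d].

Lemma box_tcons n (a : 'I_n.+1 -> R) d : @tcons R n @^-1` (box a d) =
  box (fun j => a (lift ord0 j)) d `*` `[a ord0, a ord0 + d[%classic.
Proof.
apply/seteqP; split => -[t x] /=.
  move=> h; split; last by have := h ord0; rewrite in_itv.
  by move=> j; have := h (lift ord0 j); rewrite tnthS.
move=> [h1]; rewrite in_itv /= => h2 j.
by have [i ->|->] := unliftP ord0 j; [rewrite tnthS; exact: h1|].
Qed.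

Lemma measurable_box n (a : 'I_n -> R) d : measurable (box a d).
Proof.
have -> : box a d = \bigcap_(j in [set: 'I_n])
    ((fun t : n.-tuple (measurableTypeR R) => tnth t j) @^-1` `[a j, a j + d[%classic).
  apply/seteqP; split => [t h j _|t h j]; first by rewrite /= in_itv; exact: h.
  by have := h j I; rewrite /= in_itv.
apply: fin_bigcap_measurable => // j _; rewrite -[X in measurable X]setTI.
exact: (measurable_tnth j).
Qed.

Lemma lebn_box n (a : 'I_n -> R) d : 0 <= d -> lebn R n (box a d) = (d ^+ n)%:E.
Proof.
move=> d0; elim: n a => [|n ih] a.
  rewrite /= diracE mem_set// => -[]//.
rewrite /= /pushforward box_tcons product_measure1E//=; last exact: measurable_box.
rewrite ih lebesgue_measure_itv /= lte_fin ltrDl.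
rewrite exprSr EFinM; congr (_ * _)%E.
case: ltP => // d'; first by rewrite -EFinD addrAC subrr add0r.
by congr EFin; apply/eqP; rewrite eq_le d0 d'.
Qed.

Lemma grid_integral_le n (S : 'rV[R]_n -> \bar R) (Y : R) (K : nat)
    (a : {ffun 'I_n -> 'I_K} -> R) : 0 < Y -> (0 < K)%N ->
  (forall xi, 0 <= S xi)%E -> (forall f, 0 <= a f) ->
  (forall (f : {ffun 'I_n -> 'I_K}) (xi : 'rV[R]_n),
    (forall j, grid Y K (f j) <= xi 0 j < grid Y K (f j) + 2 * Y / K%:R) ->
    ((a f)%:E <= S xi)%E) ->
  ((\sum_f (2 * Y / K%:R) ^+ n * a f)%:E <= integral_rV S)%E.
Proof.
move=> Y0 K0 S0 a0 aS; set d := 2 * Y / K%:R.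
have d0 : 0 < d by rewrite divr_gt0 ?mulr_gt0 ?ltr0n.
pose Q (f : {ffun 'I_n -> 'I_K}) := box (fun j => grid Y K (f j)) d.
have mQ f : measurable (Q f) by exact: measurable_box.
(* Cells are disjoint: if a point lies in cells $c$ and $e$ along an axis, then $c < e + 1$ and $e <
   c + 1$. *)
have Qinj f g t : Q f t -> Q g t -> f = g.
  move=> hf hg; apply/ffunP => j; apply/val_inj => /=.
  have aux (c e : nat) : grid Y K c < grid Y K e + d -> (c <= e)%N.
    rewrite /grid -/d -addrA ltrD2l -{3}(mulr1 d) -mulrDr ltr_pM2l// natr1 ltr_nat.
    by rewrite ltnS.
  have /andP[f1 f2] := hf j; have /andP[g1 g2] := hg j.
  apply/eqP; rewrite eqn_leq; apply/andP; split; apply: aux.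
    exact: le_lt_trans f1 g2.
  exact: le_lt_trans g1 f2.
(* The step function equal to [a f] on [Q f]; it is below [S], because at most one of its terms is
   nonzero at each point. *)
apply: (@le_trans _ _ (\int[lebn R n]_t (\sum_f ((a f)%:E * (\1_(Q f) t)%:E)))%E).
  rewrite ge0_integral_sum//; last first.
  - by move=> f t _; rewrite mule_ge0// lee_fin.
  - move=> f; apply: emeasurable_funM => //; apply/measurable_EFinP.
    exact: measurable_indic.
  rewrite -sumEFin; apply: lee_sum => f _.
  rewrite ge0_integralZl//; last first.
  - by rewrite lee_fin.
  - by apply/measurable_EFinP; exact: measurable_indic.
  by rewrite integral_indic// setIT lebn_box ?(ltW d0)// EFinM muleC.
apply: ge0_le_integral_nonmeas => t.
  by apply: sume_ge0 => f _; rewrite mule_ge0// lee_fin.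
have [[f Qf]|nQ] := pselect (exists f, Q f t); last first.
  rewrite big1// => f _; rewrite indicE memNset ?mule0// => Qf.
  by apply: nQ; exists f.
rewrite (bigD1 f)//= big1 => [|g gf].
  rewrite adde0 indicE mem_set// mule1; apply: aS => j.
  by rewrite /rV_of_tuple mxE; exact: Qf.
rewrite indicE memNset ?mule0// => Qg.
by move: gf; rewrite (Qinj _ _ _ Qg Qf) eqxx.
Qed.

End grid_integral.

(** * Passing from Riemann sums to the integral under the pairing with [T] *)

Section riemann_sums.
Set Implicit Arguments.
Unset Strict Implicit.
Variable R : realType.
Local Notation C := R[i].
Local Open Scope complex_scope.
Local Notation normc := (@Normc.normc R).
Local Notation Re := (@complex.Re R).
Variable n : nat.
Local Notation E := 'rV[R]_n.
Variables (j0 : 'I_n) (T : (E -> C) -> C) (z w l : 'I_n -> C).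
Hypotheses (temperedT : tempered T) (z0 : forall j, 0 < Re (z j))
  (w0 : forall j, 0 < Re (w j)).
Hypothesis hl : forall j, exists2 B : R, 0 <= B &
  forall u, 0 <= u -> normc (fprim (z j) u - l j) <= B / (1 + u).

(** Distributivity turns the product of the [n] one-variable sums into one sum over the [K ^ n]
    nodes of the grid, indexed by finite functions. *)
Lemma tensor_theta Y K :
  tensor (fun j => jet_mul (gjet (w j)) (theta (z j) Y K)) [::] =
  fun x : E => \sum_(f : {ffun 'I_n -> 'I_K}) ((2 * Y / K%:R) ^+ n)%:C *
    tensor (fun j => gfam (z j) (w j) (grid Y K (f j))) [::] x.
Proof.
apply/funext => x; rewrite /tensor.
rewrite (eq_bigr (fun j => \sum_(c < K) (2 * Y / K%:R)%:C *
    gfam (z j) (w j) (grid Y K c) 0 (x 0 j))); last first.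
  move=> j _; rewrite /jet_mul /= /theta mulr_sumr; apply: eq_bigr => c _.
  by rewrite mulrCA.
rewrite bigA_distr_bigA; apply: eq_bigr => f _.
rewrite big_split /= prodr_const card_ord; congr (_ * _).
by rewrite rmorphXn.
Qed.

Lemma tensor_cst :
  tensor (fun j => jet_mul (gjet (w j)) (cst_jet (2 * l j))) [::] =
  fun x : E => (\prod_j (2 * l j)) * tensor (fun j => gjet (w j)) [::] x.
Proof.
apply/funext => x; rewrite /tensor -big_split /=; apply: eq_bigr => j _.
by rewrite /jet_mul /= mulrC.
Qed.

(** Up to an error of order $1/Y$, the left-hand side is [c] times the pairing of [T] with a Riemann
    sum; that is at most a sum of moduli over the nodes, which a step function below [S]
    controls. *)
Lemma tempered_gauss_le (S : E -> \bar R) (c J : R) : 0 < c ->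
  (forall xi : E, (c * normc (T (tensor
     (fun j => gfam (z j) (w j) (xi 0 j)) [::])))%:E <= S xi)%E ->
  (integral_rV S <= J%:E)%E ->
  c * (normc (T (tensor (fun j => gjet (w j)) [::])) *
       \prod_j normc (2 * l j)) <= J.
Proof.
move=> c0 hS hJ; rewrite mulrC -ler_pdivlMr//; set I := J / c.
have [k [M M0 lip]] := tempered_tensor_lip j0 temperedT.
have [A A0 hA] := finite_uniform (P := fun j B =>
    forall xi, jet_bound k B (gfam (z j) (w j) xi))
  (fun j => gfam_bound (z0 j) (w0 j) k)
  (fun j B B' BB' h xi => jet_boundW BB' (h xi)).
have [L L0 hL] := finite_uniform (P := fun j B => forall xi xi',
    jet_bound k (B * `|xi - xi'|)
      (fun i t => gfam (z j) (w j) xi i t - gfam (z j) (w j) xi' i t))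
  (fun j => gfam_lipschitz (z0 j) (w0 j) k)
  (fun j B B' BB' h xi xi' => jet_boundW (ler_wpM2r (normr_ge0 _) BB') (h xi xi')).
have hr (Y : R) K : 0 <= Y -> 0 <= Y * (2 * Y / K%:R) + (1 + Y)^-1.
  by move=> Y0; rewrite addr_ge0 ?invr_ge0 ?addr_ge0// mulr_ge0// divr_ge0// mulr_ge0.
have [D D0 hD] := finite_uniform (P := fun j B => forall Y K, 0 <= Y -> (0 < K)%N ->
    jet_bound k (B * (Y * (2 * Y / K%:R) + (1 + Y)^-1)) (fun i t =>
      jet_mul (gjet (w j)) (theta (z j) Y K) i t -
      jet_mul (gjet (w j)) (cst_jet (2 * l j)) i t))
  (fun j => let: ex_intro2 _ B0 hB := hl j in theta_bound (z0 j) (w0 j) k B0 hB)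
  (fun j B B' BB' h Y K Y0 K0 =>
    jet_boundW (ler_wpM2r (hr Y K Y0) BB') (h Y K Y0 K0)).
have [Bc Bc0 hBc] := finite_uniform (P := fun j B =>
    jet_bound k B (jet_mul (gjet (w j)) (cst_jet (2 * l j))))
  (fun j => decays_jet_bound k (decays_mul_cst (w0 j) (2 * l j)))
  (fun j B B' => @jet_boundW _ k B B' _).
(* One bound for all jets involved; 3 bounds the rate $Y d + 1/(1 + Y)$ of [theta_bound], see
   [rate3]. *)
pose B := 1 + A + Bc + D * 3.
have D30 : 0 <= D * 3 by exact: mulr_ge0.
have B1 : 1 <= B by rewrite /B; lra.
pose c1 := M * B ^+ n.
have c10 : 0 <= c1 by rewrite mulr_ge0// exprn_ge0// (le_trans ler01).
rewrite -subr_le0.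
apply: (le0_div_nat (K := c1 * (D * 3) + 2 ^+ n * (c1 * (L * 2)))) => N.
(* The Lipschitz error on each cube is multiplied by the total volume $(2Y)^n$. The exponent $n + 2$
   makes $Y^n d = 2/Y$, so that even this product vanishes in the limit. *)
pose Y : R := N.+1%:R; pose K := (N.+1 ^ n.+2)%N.
have n0 : (0 < n)%N by case: j0 => m; case: (n).
have Y0 : 0 < Y by rewrite ltr0n.
have Y1 : 1 <= Y by rewrite ler1n.
have K0 : (0 < K)%N by rewrite expn_gt0.
have KY : K%:R = Y ^+ n.+2 :> R by rewrite natrX.
set d := 2 * Y / K%:R.
have d0 : 0 <= d by rewrite divr_ge0// mulr_ge0// ltW.
have dE : Y ^+ n * d = 2 / Y.
  rewrite /d KY !exprS; field.
  by rewrite expf_neq0 gt_eqF.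
have Yd : Y * d <= 2 / Y.
  by rewrite -dE ler_wpM2r// -{1}(expr1 Y) ler_weXn2l.
have Y'le : (1 + Y)^-1 <= Y^-1 by rewrite lef_pV2 ?posrE ?addr_gt0// lerDr.
have Yinv : Y^-1 <= 1 by rewrite invf_le1.
have rate : Y * d + (1 + Y)^-1 <= 3 / Y.
  by rewrite (_ : 3 / Y = 2 / Y + Y^-1); [exact: lerD|ring].
have rate3 : Y * d + (1 + Y)^-1 <= 3.
  by apply: le_trans rate _; rewrite ler_piMr.
pose hth j := jet_mul (gjet (w j)) (theta (z j) Y K).
pose hc j := jet_mul (gjet (w j)) (cst_jet (2 * l j)).
have bth j : jet_bound k B (hth j).
  move=> i t ik; rewrite -(subrK (hc j i t) (hth j i t)).
  apply: (@le_trans _ _ (D * (Y * d + (1 + Y)^-1) + Bc)).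
    apply: le_trans (lerD (hD j Y K (ltW Y0) K0 i t ik) (hBc j i t ik)).
    by rewrite -mulrDr ler_wpM2l ?exprn_ge0 ?addr_ge0// le_normcD.
  have := ler_wpM2l D0 rate3; rewrite /B; lra.
have bc j : jet_bound k B (hc j).
  by apply: jet_boundW (hBc j); rewrite /B; lra.
have bg j xi : jet_bound k B (gfam (z j) (w j) xi).
  by apply: jet_boundW (hA j xi); rewrite /B; lra.
have step1 : normc (T (tensor hth [::]) - T (tensor hc [::])) <= c1 * (D * (3 / Y)).
  apply: (lip hth hc B (D * (3 / Y))) => // j.
  - by apply: is_jet_mul; [exact: gjet_is_jet|exact: is_jet_theta].
  - exact: decays_mul_theta.
  - by apply: is_jet_mul; [exact: gjet_is_jet|exact: is_jet_cst].
  - exact: decays_mul_cst.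
  - by apply: jet_boundW (hD j Y K (ltW Y0) K0); rewrite ler_wpM2l.
pose m (xi : 'I_n -> R) := T (tensor (fun j => gfam (z j) (w j) (xi j)) [::]).
have mlip (xi xi' : 'I_n -> R) : (forall j, `|xi j - xi' j| <= d) ->
    normc (m xi) <= normc (m xi') + c1 * (L * d).
  move=> hxi; rewrite -lerBlDl.
  apply: (@le_trans _ _ (normc (m xi - m xi'))).
    by rewrite lerBlDl; have := le_normcD (m xi - m xi') (m xi'); rewrite subrK addrC.
  apply: lip => // j; [exact: is_jet_gfam|exact: decays_gfam|exact: is_jet_gfam|
    exact: decays_gfam|].
  by apply: jet_boundW (hL j (xi j) (xi' j)); rewrite ler_wpM2l.
pose g (f : {ffun 'I_n -> 'I_K}) j := grid Y K (f j).
(* A lower bound of the modulus of the pairing on the whole cube, cut at 0 because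
   [grid_integral_le] needs nonnegative values. *)
pose a f := Num.max 0 (normc (m (g f)) - c1 * (L * d)).
have suma : \sum_f d ^+ n * a f <= I.
  rewrite /I ler_pdivlMr// mulr_suml -lee_fin; apply: le_trans hJ.
  have ca f : d ^+ n * a f * c = d ^+ n * (c * a f) by rewrite -mulrA (mulrC c).
  under eq_bigr do rewrite ca.
  apply: grid_integral_le => //.
  - move=> xi; apply: le_trans (hS xi); rewrite lee_fin.
    by rewrite mulr_ge0 ?normc_ge0// ltW.
  - by move=> f; rewrite mulr_ge0 ?(ltW c0)// /a le_max lexx.
  move=> f xi hxi; apply: le_trans (hS xi).
  rewrite lee_fin ler_pM2l// /a ge_max normc_ge0 /= lerBlDr.
  apply: mlip => j; have /andP[h1 h2] := hxi j.
  rewrite distrC ger0_norm ?subr_ge0//.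
  by rewrite lerBlDl ltW.
have sum2 : normc (T (tensor hth [::])) <= I + 2 ^+ n * (c1 * (L * 2)) / Y.
  pose D' (f : {ffun 'I_n -> 'I_K}) := tensor (fun j => gfam (z j) (w j) (g f j)).
  have gD' f : good_mjet (D' f).
    by apply: good_tensor => j; [exact: is_jet_gfam|exact: decays_gfam].
  rewrite tensor_theta.
  rewrite (tempered_sum j0 temperedT (index_enum _) (d ^+ n)%:C gD').
  apply: (le_trans (normc_sum _ _ _)).
  apply: (@le_trans _ _ (\sum_(f : {ffun 'I_n -> 'I_K}) (d ^+ n * a f + d ^+ n * (c1 * (L * d))))).
    apply: ler_sum => f _; rewrite Normc.normcM normc_real ger0_norm ?exprn_ge0//.
    rewrite -mulrDr ler_wpM2l ?exprn_ge0// -lerBlDr /a le_max.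
    by rewrite lexx orbT.
  rewrite big_split /= lerD// sumr_const card_ffun !card_ord.
  have -> : (d ^+ n * (c1 * (L * d))) *+ (K ^ n) =
      (K%:R * d) ^+ n * d * (c1 * L).
    rewrite -[LHS]mulr_natr natrX [(K%:R * d) ^+ n]exprMn.
    by move: (d ^+ n) (K%:R ^+ n) => u v; ring.
  have -> : K%:R * d = 2 * Y by rewrite mulrC divfK// pnatr_eq0 -lt0n.
  have -> : (2 * Y) ^+ n * d * (c1 * L) = 2 ^+ n * (c1 * L) * (Y ^+ n * d).
    by rewrite exprMn; ring.
  by rewrite dE le_eqVlt; apply/orP; left; apply/eqP; ring.
(* In the limit each sum [theta] becomes the constant [2 * l j], which leaves the pairing by
   linearity. *)
have vE : normc (T (tensor (fun j => gjet (w j)) [::])) * \prod_j normc (2 * l j) =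
    normc (T (tensor hc [::])).
  rewrite tensor_cst temperedZ//; last first.
    by apply: good_tensor => j; [exact: gjet_is_jet|exact: decays_gjet].
  by rewrite Normc.normcM normc_prod mulrC.
rewrite vE -/Y.
have := le_normcD (T (tensor hth [::])) (- (T (tensor hth [::]) - T (tensor hc [::]))).
rewrite normcN opprB [_ + (_ - _)]addrC subrK => hv.
have -> : (c1 * (D * 3) + 2 ^+ n * (c1 * (L * 2))) / Y =
  c1 * (D * (3 / Y)) + 2 ^+ n * (c1 * (L * 2)) / Y by ring.
by rewrite lerBlDl addrCA (le_trans hv)// addrC lerD.
Qed.

End riemann_sums.

(** * The chirp, the Gaussian windows and the bound on the oscillatory integral *)

Section gaussian_windows.
Set Implicit Arguments.
Unset Strict Implicit.
Variable R : realType.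
Local Notation C := R[i].
Local Open Scope complex_scope.
Local Notation normc := (@Normc.normc R).
Local Notation Re := (@complex.Re R).

Lemma expR_expiM (a b c d : R) :
  (expR a)%:C * expi b * ((expR c)%:C * expi d) = (expR (a + c))%:C * expi (b + d).
Proof. by rewrite expRD expiD rmorphM /=; ring. Qed.

Lemma conj_realC (x : R) : Num.conj x%:C = x%:C.
Proof. by rewrite conj_Creal//; apply/complex_realP; exists x. Qed.

(* Completing the square in [xi]: the product of the chirp by the translated
   Gaussian [u |-> e^{- (q - s + i) u^2 / (2 h)}] is a time-frequency shift of
   the window, by the real amount [(1 - s / q) xi] in position. *)
Lemma cgaussM_window (h q s x xi : R) : h != 0 -> q != 0 ->
  cgauss (s / (2 * h) -i* (1 / (2 * h))) x *
  cgauss ((q - s) / (2 * h) +i* (1 / (2 * h))) (xi + x) =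
  cgauss ((s - s ^+ 2 / q) / (2 * h) +i* (1 / (2 * h))) xi *
  (expi (- (xi * x / h)) *
   (expR (- (1 / (2 * h) * (q * (x + (1 - s / q) * xi) ^+ 2))))%:C).
Proof.
move=> h0 q0; rewrite /cgauss /= [expi _ * _%:C]mulrC !expR_expiM.
congr ((expR _)%:C * expi _); field.
  by rewrite q0 h0.
by rewrite h0.
Qed.

Variables (h : R) (n : nat).
Hypothesis h0 : 0 < h.
Variable j0 : 'I_n.
Local Notation E := 'rV[R]_n.

(** Chosen so that [cgauss (chirp s)] is $e^{(i - s) y^2 / 2h}$. *)
Definition chirp (s : R) : C := s / (2 * h) -i* (1 / (2 * h)).

(** The regularizing function is itself the Gaussian $e^{-|x|^2 / 2h}$; dilated by [e], it amounts
    to the damping $s = e^2$. *)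
Lemma chirp_tensor (e : R) : (fun x : E => expi (dotv x x / (2 * h)) *
    tensor (fun=> gjet (1 / (2 * h))%:C) [::] (e *: x)) =
  tensor (fun=> gjet (chirp (e ^+ 2))) [::].
Proof.
apply/funext => x; rewrite /dotv mulr_suml expi_sum /tensor -big_split /=.
apply: eq_bigr => j _; rewrite /cgauss /= mxE mul0r oppr0 expi0 mulr1 mulrC.
by congr ((expR _)%:C * expi _); ring.
Qed.

Variables (q : nat -> R) (q0 : forall j, 0 < q j).

(** The product over the coordinates of [cgaussM_window]; the inverse power undoes the normalization
    of [gauss_window]. *)
Lemma window_tensor (s : R) (xi : E) :
  tensor (fun j => gfam ((q j - s) / (2 * h) +i* (1 / (2 * h))) (chirp s) (xi 0 j)) [::] =
  fun x : E => (\prod_(j < n) cgauss ((s - s ^+ 2 / q j) / (2 * h) +i* (1 / (2 * h))) (xi 0 j)) *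
    ((((2 * pi * h) `^ (- (n%:R / 2)))^-1)%:C *
      (expi (- (dotv xi x / h)) *
      (gauss_window h q (x - \row_j (- ((1 - s / q j) * xi 0 j))))^*)).
Proof.
set P := _ `^ _.
have PV : (P^-1)%:C * P%:C = 1.
  by rewrite -rmorphM mulVf// gt_eqF// powR_gt0// !mulr_gt0// pi_gt0.
apply/funext => x; rewrite /gauss_window conj_realC -/P rmorphM.
rewrite [expi _ * (_ * _)]mulrCA [(P^-1)%:C * _]mulrA PV [(1 : C) * _]mul1r.
rewrite /dotv mulr_suml -sumrN expi_sum mulr_sumr -sumrN.
rewrite expR_sum rmorph_prod -!big_split /=.
apply: eq_bigr => j _; rewrite /chirp /gfam /jet_mul /= /jet_shift /=.
rewrite cgaussM_window ?gt_eqF// !mxE.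
by congr (_ * (expi _ * (expR (- (_ * (_ * _ ^+ 2))))%:C)); ring.
Qed.

(** Factor by factor, after squaring: $4 |l_j|^2 \ge \pi / |z_j|$ and $2h |z_j| = \sqrt{1 + (q_j -
    s)^2} \le e^{q_j^2}$. *)
Lemma prod_normc_ge (s : R) (l : 'I_n -> C) : (forall j : 'I_n, 0 < s < q j) ->
  (forall j : 'I_n, pi / 4 <=
    normc ((q j - s) / (2 * h) +i* (1 / (2 * h))) * normc (l j) ^+ 2) ->
  ((2 * pi * h) `^ (- (n%:R / 2)))^-1 * expR (- \sum_(j < n) q j ^+ 2) <=
    \prod_(j < n) normc (2 * l j).
Proof.
move=> sq hl; have c0 : 0 < 2 * pi * h by rewrite !mulr_gt0// pi_gt0.
have -> : ((2 * pi * h) `^ (- (n%:R / 2)))^-1 = Num.sqrt (2 * pi * h) ^+ n.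
  rewrite powRN invrK -powR12_sqrt ?(ltW c0)// -powR_mulrn ?powR_ge0// -powRrM.
  by congr (_ `^ _); ring.
rewrite -sumrN expR_sum.
rewrite -[X in _ ^+ X]card_ord -prodr_const -big_split /=.
apply: ler_prod => j _; rewrite mulr_ge0 ?expR_ge0 ?sqrtr_ge0//=.
have /andP[s0 sqj] := sq j.
rewrite -(@ler_pXn2r _ 2) ?nnegrE ?mulr_ge0 ?expR_ge0 ?sqrtr_ge0 ?normc_ge0//.
rewrite exprMn sqr_sqrtr ?(ltW c0)// Normc.normcM exprMn.
have -> : normc 2 = 2 by rewrite -(rmorph_nat (real_complex R)) normc_real normr_nat.
set X := expR (q j ^+ 2).
have X1 : 1 <= X by rewrite -expR0 ler_expR sqr_ge0.
have X0 : 0 < X by exact: expR_gt0.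
have h20 : 0 < 2 * h by exact: mulr_gt0.
have nz : normc ((q j - s) / (2 * h) +i* (1 / (2 * h))) <= X / (2 * h).
  rewrite -(@ler_pXn2r _ 2) ?nnegrE ?normc_ge0 ?divr_ge0 ?(ltW X0) ?(ltW h20)//.
  rewrite normc_sqr /= !expr_div_n -mulrDl ler_wpM2r ?invr_ge0 ?sqr_ge0//.
  apply: (@le_trans _ _ X).
    apply: le_trans (expR_ge1Dx (q j ^+ 2)).
    rewrite expr1n addrC lerD2l lerXn2r ?nnegrE ?subr_ge0 ?(ltW sqj) ?(ltW (q0 j))//.
    by rewrite lerBlDr lerDl ltW.
  by rewrite expr2 ler_peMl// ltW.
have hX : pi / 4 <= X / (2 * h) * normc (l j) ^+ 2.
  by apply: le_trans (hl j) _; rewrite ler_wpM2r ?sqr_ge0.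
have {hX} hX : 2 * pi * h / X <= 2 ^+ 2 * normc (l j) ^+ 2.
  rewrite ler_pdivrMr//.
  have -> : 2 * pi * h = pi / 4 * (8 * h) by field.
  have -> : 2 ^+ 2 * normc (l j) ^+ 2 * X = X / (2 * h) * normc (l j) ^+ 2 * (8 * h).
    by field; rewrite gt_eqF.
  by rewrite ler_wpM2r// mulr_ge0// ltW.
(* Here $1/X$ is available while only $1/X^2$ is required. *)
apply: le_trans hX; rewrite ler_wpM2l ?(ltW c0)// expRN -/X expr2.
by rewrite ler_piMl ?invr_ge0 ?(ltW X0)// invf_le1.
Qed.

Lemma schwartz_gauss (a : R) : 0 < a -> schwartz (@tensor R n (fun=> gjet a%:C) [::]).
Proof.
move=> a0; apply: (good_schwartz j0); apply: good_tensor => j.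
  exact: gjet_is_jet.
exact: decays_gjet.
Qed.

Variables (T : (E -> C) -> C) (temperedT : tempered T).

(** Of the factors $P$ of [tempered_gauss_le], one comes from [stft] and one from the normalization
    of the window; the lower bound $P^{-1} e^{-\sum q_j^2}$ of the product cancels one of them. *)
Lemma tempered_chirp_le (s J : R) : (forall j : 'I_n, 0 < s < q j) ->
  (Minf1_norm h (gauss_window h q) T <= J%:E)%E ->
  (2 * pi * h) `^ (- (n%:R / 2)) *
    normc (T (tensor (fun=> gjet (chirp s)) [::])) <=
  expR (\sum_(j < n) q j ^+ 2) * J.
Proof.
move=> sq hJ; set P := _ `^ _.
have P0 : 0 < P by rewrite powR_gt0// !mulr_gt0// pi_gt0.
pose z (j : 'I_n) : C := (q j - s) / (2 * h) +i* (1 / (2 * h)).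
have h20 : 0 < 2 * h by exact: mulr_gt0.
have z0 j : 0 < Re (z j).
  by have /andP[s0 sj] := sq j; rewrite /= divr_gt0// subr_gt0.
have s0 : 0 < s by have /andP[] := sq j0.
have w0 : 0 < Re (chirp s) by rewrite /= divr_gt0.
have /choice[l hl] : forall j, exists l : C, exists2 B : R, 0 <= B &
    (forall u, 0 <= u -> normc (fprim (z j) u - l) <= B / (1 + u)) /\
    pi / 4 <= normc (z j) * normc l ^+ 2 by move=> j; exact: fresnel_limit.
have hrate j : exists2 B : R, 0 <= B &
    forall u, 0 <= u -> normc (fprim (z j) u - l j) <= B / (1 + u).
  by have [B B0 [hB _]] := hl j; exists B.
have hlow j : pi / 4 <= normc (z j) * normc (l j) ^+ 2.
  by have [B B0 [_]] := hl j.
have hprod := prod_normc_ge sq hlow; rewrite -/P in hprod.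
have hS (xi : E) : ((P ^+ 2 * normc (T (tensor
      (fun j => gfam (z j) (chirp s) (xi 0 j)) [::])))%:E <=
    ereal_sup [set (normc (stft h (gauss_window h q) T x xi))%:E | x in [set: E]])%E.
  (* The supremum is bounded below by its value at the one position where the shifted window
     appears. *)
  set x0 : E := \row_j (- ((1 - s / q j) * xi 0 j)).
  apply: (@le_trans _ _ (normc (stft h (gauss_window h q) T x0 xi))%:E); last first.
    by apply: ereal_sup_ubound; exists x0.
  pose kap := \prod_(j < n) cgauss ((s - s ^+ 2 / q j) / (2 * h) +i* (1 / (2 * h))) (xi 0 j).
  (* The modulus is at most 1 because $s < q_j$ makes $s - s^2 / q_j$ positive. *)
  have kap1 : 0 < normc kap <= 1.
    rewrite /kap normc_prod; apply/andP; split.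
      by apply: prodr_gt0 => j _; rewrite normc_cgauss expR_gt0.
    apply: (@le_trans _ _ (\prod_(j < n) 1)); last by rewrite big1_eq.
    apply: ler_prod => j _; apply/andP; split; first exact: normc_ge0.
    apply: normc_cgauss_le1; rewrite [complex.Re _]/= divr_gt0//.
    have /andP[_ sj] := sq j.
    by rewrite subr_gt0 ltr_pdivrMr// expr2 ltr_pM2l.
  have /andP[kap0 kap_le1] := kap1.
  have kapN0 : kap != 0.
    by apply/eqP => k0; move: kap0; rewrite k0 Normc.normc0 ltxx.
  pose W : E -> C := fun y => expi (- (dotv xi y / h)) * Num.conj (gauss_window h q (y - x0)).
  have WE : W = fun y => (kap^-1 * P%:C) *
      tensor (fun j => gfam (z j) (chirp s) (xi 0 j)) [::] y.
    apply/funext => y; rewrite window_tensor -/P -/x0 -/kap -/(W y).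
    have PV : P%:C * (P^-1)%:C = 1 by rewrite -rmorphM mulfV// gt_eqF.
    have kV : kap^-1 * kap = 1 by rewrite mulVf.
    have -> : kap^-1 * P%:C * (kap * ((P^-1)%:C * W y)) =
      (kap^-1 * kap) * (P%:C * (P^-1)%:C) * W y by ring.
    by rewrite kV PV !mul1r.
  have -> : stft h (gauss_window h q) T x0 xi = P%:C * T W by [].
  rewrite WE (temperedZ j0 temperedT); last first.
    by apply: good_tensor => j; [exact: is_jet_gfam|exact: decays_gfam].
  rewrite lee_fin.
  rewrite !Normc.normcM normc_real (ger0_norm (ltW P0)) Normc.normcV.
  set t := normc (T _).
  have -> : P * ((normc kap)^-1 * P * t) = (normc kap)^-1 * (P ^+ 2 * t) by ring.
  apply: ler_peMl; first by apply: mulr_ge0 (normc_ge0 _); exact: sqr_ge0.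
  by rewrite -invf_le1 ?invr_gt0// invrK.
have P20 : 0 < P ^+ 2 by rewrite exprn_gt0.
have := tempered_gauss_le j0 temperedT z0 (fun=> w0) hrate P20 hS hJ.
set t := normc (T _); set L := \prod_j _ => main.
have t0 : 0 <= t by exact: normc_ge0.
apply: (@le_trans _ _ (expR (\sum_(j < n) q j ^+ 2) * (P ^+ 2 * (t * L)))); last first.
  by rewrite ler_wpM2l// expR_ge0.
have -> : expR (\sum_(j < n) q j ^+ 2) * (P ^+ 2 * (t * L)) =
  (P * t) * (P * expR (\sum_(j < n) q j ^+ 2) * L) by ring.
rewrite ler_peMr ?mulr_ge0 ?(ltW P0)//.
have e0 : 0 < expR (\sum_(j < n) q j ^+ 2) by exact: expR_gt0.
apply: (@le_trans _ _ (P * expR (\sum_(j < n) q j ^+ 2) *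
   (P^-1 * expR (- \sum_(j < n) q j ^+ 2)))); last first.
  by rewrite ler_wpM2l// mulr_ge0// ltW.
rewrite expRN le_eqVlt; apply/orP; left; apply/eqP; field.
by rewrite !gt_eqF.
Qed.

Lemma Minf1_norm_ge0 (g : E -> C) : (0 <= Minf1_norm h g T)%E.
Proof.
apply: integral_ge0 => t _.
apply: (@le_trans _ _ (normc (stft h g T 0 (rV_of_tuple t)))%:E).
  by rewrite lee_fin normc_ge0.
by apply: ereal_sup_ubound; exists 0.
Qed.

Lemma osc_integral_le (J : R) :
  (Minf1_norm h (gauss_window h q) T <= J%:E)%E ->
  normc (osc_integral h T) <= expR (\sum_(j < n) q j ^+ 2) * J.
Proof.
move=> hJ; have J0 : 0 <= J.
  by rewrite -lee_fin (le_trans (Minf1_norm_ge0 (gauss_window h q))).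
(* If no limit existed, [xget] would return 0 and the bound would hold because [J] is
   nonnegative. *)
rewrite /osc_integral; case: xgetP => [l _ hl|_]; last first.
  by rewrite Normc.normc0 mulr_ge0// expR_ge0.
have a0 : 0 < 1 / (2 * h) by rewrite divr_gt0// mulr_gt0.
have phi0 : tensor (fun=> gjet (1 / (2 * h))%:C) [::] (0 : E) = 1.
  by rewrite /tensor big1// => j _; rewrite mxE /= cgauss0.
have /cvgrPdist_lt hlim := hl _ (schwartz_gauss a0) phi0.
apply/ler_addgt0Pr => e e0.
have eC : (0 : C) < e%:C by rewrite ltcR.
(* At most 1 and below each of the finitely many [q j], so that $d < b$ ensures $d^2 < q_j$ for all
   $j < n$. *)
pose b := (1 + \sum_(j < n) (q j)^-1)^-1.
have qV0 (j : 'I_n) : 0 <= (q j)^-1 by rewrite invr_ge0 ltW.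
have b0 : 0 < b by rewrite invr_gt0 ltr_pwDl// sumr_ge0.
have b1 : b <= 1 by rewrite invf_le1 ?ltr_pwDl ?sumr_ge0// lerDl sumr_ge0.
have bq (j : 'I_n) : b < q j.
  rewrite -[ltRHS]invrK ltf_pV2 ?posrE ?invr_gt0 ?ltr_pwDl ?sumr_ge0//.
  by rewrite (bigD1 j)//= lerDl sumr_ge0.
have [d [d0 db hd]] : exists d : R, [/\ 0 < d, d < b &
    `|l - ((2 * pi * h) `^ (- (n%:R / 2)))%:C * expi (- (pi * n%:R / 4)) *
      T (fun x => expi (dotv x x / (2 * h)) *
        tensor (fun=> gjet (1 / (2 * h))%:C) [::] (d *: x))| < e%:C].
  near (0 : R)^'+ => d; exists d; split.
  - by near: d; exact: nbhs_right_gt.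
  - by near: d; exact: nbhs_right_lt.
  - by near: d; exact: hlim _ eC.
have dq (j : 'I_n) : 0 < d ^+ 2 < q j.
  rewrite exprn_gt0//=; apply: le_lt_trans (bq j); apply: le_trans (ltW db).
  by rewrite expr2 ler_piMl ?(ltW d0)// (le_trans (ltW db)).
move: hd; rewrite chirp_tensor; set y := _ * T _ => hd.
have {hd} : normc (l - y) < e by rewrite -ltcR.
have ny : normc y <= expR (\sum_(j < n) q j ^+ 2) * J.
  rewrite /y Normc.normcM Normc.normcM normc_expi mulr1 normc_real.
  by rewrite ger0_norm ?powR_ge0//; exact: tempered_chirp_le dq hJ.
have := le_normcD (l - y) y; rewrite subrK; lra.
Unshelve. all: by end_near. Qed.

Lemma osc_ratio_le (K : R) : expR (\sum_(j < n) q j ^+ 2) <= K ->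
  ((normc (osc_integral h T))%:E / Minf1_norm h (gauss_window h q) T <= K%:E)%E.
Proof.
move=> hK; have K0 : 0 <= K by exact: le_trans (expR_ge0 _) hK.
have := osc_integral_le; have := Minf1_norm_ge0 (gauss_window h q).
(* For an infinite norm the quotient is 0. For a zero norm, treated next, the bound forces the
   numerator to vanish, and 0 times the inverse is again 0. *)
case: (Minf1_norm _ _ _) => [r|_ _|//]; last by rewrite invey mule0 lee_fin.
rewrite lee_fin => r0 /(_ r (lexx _)) hr.
rewrite inver; case: eqP => [re0|/eqP rN0].
  have -> : normc (osc_integral h T) = 0.
    by apply/eqP; rewrite eq_le normc_ge0 andbT (le_trans hr)// re0 mulr0.
  by rewrite mul0e lee_fin.
have rp : 0 < r by rewrite lt_neqAle eq_sym rN0.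
rewrite -EFinM lee_fin ler_pdivrMr// (le_trans hr)//.
by rewrite ler_wpM2r.
Qed.

End gaussian_windows.

Theorem corollary4p2 (R : realType) (hbar : R) (q : nat -> R)
  (hbar_gt0 : 0 < hbar) (hbar_le1 : hbar <= 1)
  (q_gt0 : forall j, 0 < q j)
  (q_sqr_summable : cvgn (series (fun j => q j ^+ 2))) :
  (ereal_sup [set osc_opnorm hbar (@gauss_window R hbar n q)
             | n in [set n : nat | (0 < n)%N]] < +oo)%E.
Proof.
pose K := expR (limn (series (fun j => q j ^+ 2))).
apply: (@le_lt_trans _ _ K%:E); last by rewrite ltry.
apply: ge_ereal_sup => _ [n /= n0 <-].
apply: ge_ereal_sup => _ [T [[temperedT _] _] <-].
(* Positivity of [n] supplies the coordinate required throughout. It remains to bound a partial sum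
   of squares by the sum of the series, which does not depend on [n]. *)
apply: (osc_ratio_le hbar_gt0 (Ordinal n0)) => //.
rewrite ler_expR -(big_mkord xpredT (fun j => q j ^+ 2)).
apply: (nondecreasing_cvgn_le (u_ := series (fun j => q j ^+ 2))) => //.
by apply: nondecreasing_series => j _ _; exact: sqr_ge0.
Qed.
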